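(* Let $(\Omega,\mathcal{A},\mu)$ be a finite measure space, let $X$ be a Banach space, and let $1\le p<+\infty$. A set $\mathcal{H}\subset L^p(\mu,X)$ is relatively norm compact if and only if it satisfies the Fréchet oscillation condition $(\mathcal{F})$, it is integral tight, and it is $p$-uniformly integrable.
   Context: $(\Omega,\mathcal{A},\mu)$ is a finite measure space: $\mathcal{A}$ is a $\sigma$-algebra and $\mu$ is a countably additive, positive, finite measure. $\mathcal{A}^+$ is the set of $E\in\mathcal{A}$ with $\mu(E)>0$. Measurable sets whose symmetric difference is $\mu$-null are identified. $X$ is a Banach space with norm $\|\cdot\|$. $L^p(\mu,X)$ is the Lebesgue-Bochner space of ($\mu$-a.e. equality classes of) strongly $\mu$-measurable functions $f:\Omega\to X$ such that $\|f\|^p$ is $\mu$-integrable, with its usual norm $\|f\|_p=(\int_\Omega\|f\|^p\,d\mu)^{1/p}$. Integrals of $X$-valued functions are Bochner integrals. $\Pi$ is the set of all finite partitions $\pi\subset\mathcal{A}^+$ of $\Omega$ (understood modulo $\mu$-null sets, in accordance with the identification of measurable sets whose symmetric difference is $\mu$-null). Relatively norm compact means having compact closure in the norm topology. Integral tight: a subset $\mathcal{H}\subset L^p(\mu,X)$ is integral tight iff for every $E\in\mathcal{A}$ the set $\{\int_E f\,d\mu : f\in\mathcal{H}\}$ is relatively norm compact in $X$. $p$-uniformly integrable: a subset $\mathcal{H}\subset L^p(\mu,X)$ is $p$-uniformly integrable iff the set $\{\|f\|^p: f\in\mathcal{H}\}$ is uniformly integrable, i.e. $\lim_{M\to+\infty}\int_{\{\|f\|^p>M\}}\|f\|^p\,d\mu=0$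 uniformly in $f\in\mathcal{H}$. Equivalently, $\mathcal{H}$ is bounded in $L^p(\mu,X)$ and $\lim_{\mu(E)\to0}\int_E\|f\|^p\,d\mu=0$ uniformly in $f\in\mathcal{H}$. Essential oscillation: for a $\mu$-measurable function $f:\Omega\to X$ and $A\in\mathcal{A}$, $$\mathrm{EssOsc}(f,A)=\inf_{B\in\mathcal{A},\ \mu(B)=0}\ \sup\{\|f(\omega)-f(\omega')\| : \omega,\omega'\in A\setminus B\},$$ with values in $[0,+\infty]$ and the supremum over the empty set being $0$. Fréchet oscillation condition $(\mathcal{F})$: a set $\mathcal{H}$ of $\mu$-measurable functions satisfies $(\mathcal{F})$ iff for every $\varepsilon>0$ there are a finite partition $\pi\in\Pi$ and, for every $f\in\mathcal{H}$, a set $\Omega_f\in\mathcal{A}$ such that $\mu(\Omega\setminus\Omega_f)\le\varepsilon$ and $\mathrm{EssOsc}(f,\Omega_f\cap A)\le\varepsilon$ for all $A\in\pi$. (The partition $\pi$ depends on $\varepsilon$ but not on $f$.) *)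

(* Defs.v *)
From HB Require Import structures.
From mathcomp Require Import all_boot all_order all_algebra.
From mathcomp Require Import generic_quotient.
From mathcomp Require Import all_classical all_reals all_analysis.
From mathcomp Require Import measurable_realfun.
Set Implicit Arguments.
Unset Strict Implicit.
Unset Printing Implicit Defensive.
Import Order.TTheory GRing.Theory Num.Theory.
Import numFieldNormedType.Exports.
Local Open Scope classical_set_scope.
Local Open Scope ring_scope.

Section strongly_measurable.
Context {d : measure_display} {T : measurableType d} {R : realType}.
Context {X : completeNormedModType R}.
Variable mu : {finite_measure set T -> \bar R}.
Implicit Types f g s t : T -> X.

Definition simple_function s :=
  finite_set (range s) /\ forall x, measurable (s @^-1` [set x]).

Definition strongly_measurable f :=
  exists s : (T -> X)^nat, (forall n, simple_function (s n)) /\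
    \forall x \ae mu, s n x @[n --> \oo] --> f x.

(* The measure is not assumed to be complete, so [f] and [`|f|] are only equal
   to measurable functions outside a null set. The library's integral of a
   nonnegative function is the supremum of the integrals of the simple
   functions below it, so changing the integrand on a null set does not change
   it (lemma [ge0_integral_ae]). *)
Definition Lp_fun (p : R) f :=
  strongly_measurable f /\ (\int[mu]_x (`|f x| `^ p)%:E < +oo)%E.

Import HBNNSimple.

Lemma ge0_integral_ae_le (f g : T -> \bar R) :
  (forall x, 0 <= f x)%E -> (forall x, 0 <= g x)%E ->
  (\forall x \ae mu, f x = g x) ->
  (\int[mu]_x f x <= \int[mu]_x g x)%E.
Proof.
move=> f0 g0 [N [mN N0 fgN]].
rewrite ge0_integralTE// [leRHS]ge0_integralTE//.
apply: ge_ereal_sup => _ [h hf <-].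
have mNC : measurable (~` N) by exact: measurableC.
have -> : sintegral mu h = sintegral mu (proj_nnsfun h mNC).
  rewrite -!integralT_nnsfun; apply: ae_eq_integral => //.
    by apply/measurable_EFinP.
  by apply/measurable_EFinP.
  exists N; split => // x /=; apply: contra_notP => Nx _.
  by rewrite /proj_nnsfun /= mindicE mem_set// mulr1.
apply: ereal_sup_ubound; exists (proj_nnsfun h mNC) => // x.
rewrite /proj_nnsfun /= mindicE; case: (boolP (x \in ~` N)) => xN.
  rewrite mulr1; have /contrapT <- : ~ ~ (f x = g x).
    by move=> /fgN; exact: (set_mem xN).
  exact: hf.
by rewrite mulr0.
Qed.

Lemma ge0_integral_ae (f g : T -> \bar R) :
  (forall x, 0 <= f x)%E -> (forall x, 0 <= g x)%E ->
  (\forall x \ae mu, f x = g x) ->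
  (\int[mu]_x f x = \int[mu]_x g x)%E.
Proof.
move=> f0 g0 fg; apply/eqP; rewrite eq_le !ge0_integral_ae_le//.
by apply: filterS fg.
Qed.

Lemma simple_function_comp2 {Y Z : Type} (h : X -> Y -> Z) s (t : T -> Y) :
  simple_function s ->
  finite_set (range t) -> (forall x, measurable (t @^-1` [set x])) ->
  finite_set (range (fun x => h (s x) (t x))) /\
  forall z, measurable ((fun x => h (s x) (t x)) @^-1` [set z]).
Proof.
move=> [fs ms] ft mt; split.
  apply: (@sub_finite_set _ _
    ((fun xy => h xy.1 xy.2) @` (range s `*` range t))).
    by move=> _ [x _ <-]; exists (s x, t x) => //; split; exists x.
  exact/finite_image/finite_setX.
move=> z; rewrite (_ : _ @^-1` _ = \bigcup_(xy in (range s `*` range t) `&`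
    [set xy | h xy.1 xy.2 = z])
    (s @^-1` [set xy.1] `&` t @^-1` [set xy.2])); last first.
  apply/seteqP; split => [x /= hz|x [[a b] /= [_ hz] [-> ->]]//].
  by exists (s x, t x) => //=; split => //; split; exists x.
apply: fin_bigcup_measurable; last by move=> *; exact: measurableI.
exact/finite_setIl/finite_setX.
Qed.

Lemma simple_functionD s t : simple_function s -> simple_function t ->
  simple_function (s + t).
Proof. by move=> ss [? ?]; exact: simple_function_comp2. Qed.

Lemma simple_function_comp {Z : Type} (h : X -> Z) s : simple_function s ->
  finite_set (range (h \o s)) /\ forall z, measurable ((h \o s) @^-1` [set z]).
Proof.
move=> ss; apply: (@simple_function_comp2 unit _ (fun x _ => h x) s (cst tt)).
- by [].
- by apply: (@sub_finite_set _ _ [set tt]) => // -[].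
- by move=> []; rewrite (_ : _ @^-1` _ = setT)//; apply/seteqP; split.
Qed.

Lemma simple_function_cst x : simple_function (cst x).
Proof.
split; first by apply: (@sub_finite_set _ _ [set x]) => // _ [? _ <-].
by move=> y; rewrite preimage_cst; case: ifP.
Qed.

Lemma strongly_measurable0 : strongly_measurable 0.
Proof.
exists (fun=> 0); split; first by move=> _; exact: (simple_function_cst 0).
by apply: aeW => x; exact: cvg_cst.
Qed.

Lemma strongly_measurableD f g : strongly_measurable f ->
  strongly_measurable g -> strongly_measurable (f + g).
Proof.
move=> [s [ss sf]] [t [st tg]]; exists (fun n => s n + t n); split.
  by move=> n; exact: simple_functionD.
by move: sf tg; apply: filterS2 => x sf tg; exact: cvgD.
Qed.

Lemma strongly_measurableZ a f : strongly_measurable f ->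
  strongly_measurable (a *: f).
Proof.
move=> [s [ss sf]]; exists (fun n => a *: s n); split.
  by move=> n; exact: (simple_function_comp ( *:%R a) (ss n)).
by move: sf; apply: filterS => x; exact: cvgZr.
Qed.

Lemma strongly_measurable_norm f : strongly_measurable f ->
  exists2 g : T -> R, measurable_fun setT g & \forall x \ae mu, `|f x| = g x.
Proof.
move=> [s [ss [N [mN N0 sfN]]]].
have mNC : measurable (~` N) by exact: measurableC.
exists (fun x => \1_(~` N) x * `|f x|); last first.
  exists N; split => // x /=; apply: contra_notP => Nx.
  by rewrite indicE mem_set// mul1r.
apply: (@measurable_fun_cvg _ _ _ _ (fun n x => \1_(~` N) x * `|s n x|)).
  move=> n; apply: measurable_funM => //.
  move: (simple_function_comp Num.norm (ss n)) => [fs ms].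
  move=> _ B mB; rewrite setTI.
  rewrite (_ : _ @^-1` _ = \bigcup_(r in range (Num.norm \o s n) `&` B)
      ((Num.norm \o s n) @^-1` [set r])).
    by apply: fin_bigcup_measurable => //; exact: finite_setIl.
  apply/seteqP; split => [x /= Bx|x [r [_ Br] /= ->]//].
  by exists `|s n x| => //; split => //; exists x.
move=> x _; rewrite indicE; case: (boolP (x \in ~` N)) => xN; last first.
  by under eq_fun do rewrite mul0r; rewrite mul0r; exact: cvg_cst.
under eq_fun do rewrite mul1r; rewrite mul1r; apply: cvg_norm.
by apply: contrapT => /sfN; exact: (set_mem xN).
Qed.

Section norm.
Variables (p : R) (p1 : 1 <= p).

Definition Lp_norm f : \bar R := 'N[mu]_p%:E[(fun x => `|f x|%:E)]%E.

Lemma Lp_normE f : Lp_norm f = ((\int[mu]_x (`|f x| `^ p)%:E) `^ p^-1)%E.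
Proof.
rewrite /Lp_norm unlock; congr (_ `^ _)%E; apply: eq_integral => x _.
by rewrite /= normr_id.
Qed.

Lemma Lp_norm_ae f (g : T -> R) : (\forall x \ae mu, `|f x| = g x) ->
  Lp_norm f = 'N[mu]_p%:E[EFin \o g]%E.
Proof.
move=> fg; rewrite /Lp_norm unlock; congr (_ `^ _)%E.
apply: ge0_integral_ae => [x|x|]; [exact: poweR_ge0..|].
by apply: filterS fg => x /= ->.
Qed.

Lemma Lp_norm_ae_eq f g : (\forall x \ae mu, f x = g x) ->
  Lp_norm f = Lp_norm g.
Proof. by move=> fg; apply: Lp_norm_ae; apply: filterS fg => x ->. Qed.

Let p_neq0 : p != 0. Proof. by rewrite gt_eqF// (lt_le_trans _ p1). Qed.

Lemma Lp_norm_lty f :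
  (\int[mu]_x (`|f x| `^ p)%:E < +oo)%E <-> (Lp_norm f < +oo)%E.
Proof.
rewrite Lp_normE; split => [|h]; first exact: poweR_lty.
have : (((\int[mu]_x (`|f x| `^ p)%:E) `^ p^-1) `^ p < +oo)%E.
  exact: poweR_lty.
rewrite -poweRrM mulVf// poweRe1//.
by apply: integral_ge0 => x _; rewrite lee_fin powR_ge0.
Qed.

Lemma Lp_normD f g : strongly_measurable f -> strongly_measurable g ->
  (Lp_norm (f + g)%R <= Lp_norm f + Lp_norm g)%E.
Proof.
move=> mf mg; have [f' mf' ff'] := strongly_measurable_norm mf.
have [g' mg' gg'] := strongly_measurable_norm mg.
have [h' mh' hh'] :=
  strongly_measurable_norm (strongly_measurableD mf mg).
rewrite (Lp_norm_ae ff') (Lp_norm_ae gg').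
apply: le_trans (minkowski_EFin mu mf' mg' p1).
rewrite (Lp_norm_ae hh') unlock; apply: gt0_ler_poweR => //.
- by rewrite invr_ge0 (le_trans _ p1).
- by rewrite in_itv/= leey andbT integral_ge0// => *; exact: poweR_ge0.
- by rewrite in_itv/= leey andbT integral_ge0// => *; exact: poweR_ge0.
apply: ae_ge0_le_integral => //.
- by move=> *; exact: poweR_ge0.
- apply: (@measurableT_comp _ _ _ _ _ _ (fun x => x `^ p)%E) => //.
    exact: measurable_poweR.
  by apply: measurableT_comp => //; exact/measurable_EFinP.
- by move=> *; exact: poweR_ge0.
- apply: (@measurableT_comp _ _ _ _ _ _ (fun x => x `^ p)%E) => //.
    exact: measurable_poweR.
  apply: measurableT_comp => //; apply/measurable_EFinP.
  exact: measurable_funD.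
near=> x => _ /=; rewrite lee_fin ge0_ler_powR ?nnegrE//.
  exact: (le_trans _ p1).
have <- : `|f x| = f' x by near: x.
have <- : `|g x| = g' x by near: x.
have <- : `|(f + g) x| = h' x by near: x.
rewrite normr_id [leRHS]ger0_norm ?addr_ge0//.
exact: ler_normD.
Unshelve. all: by end_near. Qed.

Lemma Lp_normZ a f : strongly_measurable f ->
  Lp_norm (a *: f)%R = (`|a|%:E * Lp_norm f)%E.
Proof.
move=> mf; have [->|a0] := eqVneq a 0.
  rewrite normr0 mul0e scale0r Lp_normE.
  under eq_integral do rewrite normr0 powR0//.
  by rewrite integral0 poweR0r// invr_neq0.
rewrite !Lp_normE.
have [g mg fg] := strongly_measurable_norm mf.
have -> : (\int[mu]_x (`|(a *: f)%R x| `^ p)%:E =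
           \int[mu]_x ((`|a| `^ p)%:E * (`|g x| `^ p)%:E))%E.
  apply: ge0_integral_ae => [x|x|].
  - by rewrite lee_fin powR_ge0.
  - by rewrite mule_ge0// lee_fin powR_ge0.
  - apply: filterS fg => x /= fgx.
    by rewrite -EFinM -powRM// -fgx normr_id -normrZ.
have -> : (\int[mu]_x (`|f x| `^ p)%:E = \int[mu]_x (`|g x| `^ p)%:E)%E.
  apply: ge0_integral_ae => [x|x|]; try by rewrite lee_fin powR_ge0.
  by apply: filterS fg => x fgx; rewrite -fgx normr_id.
have mgp : measurable_fun setT (fun x => (`|g x| `^ p)%:E).
  apply/measurable_EFinP.
  apply: (@measurableT_comp _ _ _ _ _ _ (fun x => x `^ p)) => //.
  exact: measurableT_comp.
rewrite ge0_integralZl_EFin ?powR_ge0//.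
have I0 : (0 <= \int[mu]_x (`|g x| `^ p)%:E)%E.
  by apply: integral_ge0 => x _; rewrite lee_fin powR_ge0.
rewrite poweRM ?lee_fin ?powR_ge0//.
by rewrite poweR_EFin -powRrM mulfV// powRr1.
Qed.

End norm.
End strongly_measurable.

Section Lp_space.
Context {d : measure_display} {T : measurableType d} {R : realType}.
Variables (mu : {finite_measure set T -> \bar R}) (X : completeNormedModType R).
Variables (p : R) (p1 : 1 <= p).

Let p_neq0 : p != 0. Proof. by rewrite gt_eqF// (lt_le_trans _ p1). Qed.

(* [p1] is unused, but the instances below need it to appear in the type. *)
Definition Lp_pred (_ : 1 <= p) : {pred T -> X} := fun f => `[< Lp_fun mu p f >].

Lemma Lp_pred_submod_closed : submod_closed (Lp_pred p1).
Proof.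
split.
  apply/asboolP; split; first exact: strongly_measurable0.
  under eq_integral do rewrite normr0 powR0//.
  by rewrite integral0.
move=> a f g /asboolP[mf /(Lp_norm_lty mu p1) f_fin].
move=> /asboolP[mg /(Lp_norm_lty mu p1) g_fin].
have maf := strongly_measurableZ a mf.
apply/asboolP; split; first exact: strongly_measurableD.
apply/(Lp_norm_lty mu p1)/(le_lt_trans (Lp_normD p1 maf mg)).
by rewrite lte_add_pinfty// Lp_normZ// lte_mul_pinfty// lee_fin.
Qed.

HB.instance Definition _ :=
  GRing.isSubmodClosed.Build R (T -> X) (Lp_pred p1) Lp_pred_submod_closed.

Record Lp_funType := LpFun { Lp_val :> T -> X; Lp_valP : Lp_val \in Lp_pred p1 }.

HB.instance Definition _ := [isSub for Lp_val].
HB.instance Definition _ := [Choice of Lp_funType by <:].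
HB.instance Definition _ := [SubChoice_isSubLmodule of Lp_funType by <:].

Implicit Types f g : Lp_funType.

Definition Lp_eq f g := `[< \forall x \ae mu, f x = g x >].

Lemma Lp_eq_refl : reflexive Lp_eq.
Proof. by move=> f; apply/asboolP; exact: aeW. Qed.

Lemma Lp_eq_sym : symmetric Lp_eq.
Proof.
by move=> f g; apply/asboolP/asboolP; apply: filterS => x.
Qed.

Lemma Lp_eq_trans : transitive Lp_eq.
Proof.
move=> g f h /asboolP fg /asboolP gh; apply/asboolP.
by move: fg gh; apply: filterS2 => x -> ->.
Qed.

Canonical Lp_eq_equiv := EquivRel Lp_eq Lp_eq_refl Lp_eq_sym Lp_eq_trans.

Local Open Scope quotient_scope.

Definition Lp : Type := {eq_quot Lp_eq}.
HB.instance Definition _ := Choice.on Lp.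
HB.instance Definition _ := EqQuotient.on Lp.

(* An arbitrary representative; the conditions of section [conditions] do not
   depend on this choice. *)
Definition Lp_repr (u : Lp) : T -> X := (repr u : Lp_funType).

Lemma Lp_piP f g : \pi_Lp f = \pi_Lp g <-> \forall x \ae mu, f x = g x.
Proof.
split=> [/eqP|fg]; first by rewrite eqmodE => /asboolP.
by apply/eqP; rewrite eqmodE; apply/asboolP.
Qed.

Lemma Lp_repr_pi f : \forall x \ae mu, repr (\pi_Lp f) x = f x.
Proof. by apply/Lp_piP; rewrite reprK. Qed.

Implicit Types u v w : Lp.

Definition Lp_zero : Lp := \pi_Lp 0.
Definition Lp_opp u : Lp := \pi_Lp (- repr u).
Definition Lp_add u v : Lp := \pi_Lp (repr u + repr v).
Definition Lp_scale (a : R) u : Lp := \pi_Lp (a *: repr u).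

Lemma Lp_valN f x : (- f) x = - f x. Proof. by []. Qed.
Lemma Lp_valD f g x : (f + g) x = f x + g x. Proof. by []. Qed.
Lemma Lp_valZ a f x : (a *: f) x = a *: f x. Proof. by []. Qed.

Lemma Lp_pi_opp f : \pi_Lp (- f) = Lp_opp (\pi_Lp f).
Proof.
by apply/Lp_piP; apply: filterS (Lp_repr_pi f) => x; rewrite !Lp_valN => ->.
Qed.

Lemma Lp_pi_add f g : \pi_Lp (f + g) = Lp_add (\pi_Lp f) (\pi_Lp g).
Proof.
apply/Lp_piP.
by apply: filterS2 (Lp_repr_pi f) (Lp_repr_pi g) => x fx gx;
  rewrite !Lp_valD fx gx.
Qed.

Lemma Lp_pi_scale a f : \pi_Lp (a *: f) = Lp_scale a (\pi_Lp f).
Proof.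
by apply/Lp_piP; apply: filterS (Lp_repr_pi f) => x; rewrite !Lp_valZ => ->.
Qed.

Lemma Lp_pi_ind (P : Lp -> Prop) : (forall f, P (\pi_Lp f)) -> forall u, P u.
Proof. by move=> Ppi u; rewrite -[u]reprK. Qed.

Lemma Lp_addA : associative Lp_add.
Proof.
elim/Lp_pi_ind=> f; elim/Lp_pi_ind=> g; elim/Lp_pi_ind=> h.
rewrite -(Lp_pi_add g h) -(Lp_pi_add f g).
by rewrite -(Lp_pi_add f) -(Lp_pi_add _ h) addrA.
Qed.

Lemma Lp_addC : commutative Lp_add.
Proof. by move=> u v; rewrite /Lp_add addrC. Qed.

Lemma Lp_add0 : left_id Lp_zero Lp_add.
Proof. by elim/Lp_pi_ind=> f; rewrite -(Lp_pi_add 0 f) add0r. Qed.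

Lemma Lp_addN : left_inverse Lp_zero Lp_opp Lp_add.
Proof.
by elim/Lp_pi_ind=> f; rewrite -(Lp_pi_opp f) -(Lp_pi_add (- f) f) addNr.
Qed.

HB.instance Definition _ :=
  GRing.isZmodule.Build Lp Lp_addA Lp_addC Lp_add0 Lp_addN.

Lemma Lp_scaleA a b u : Lp_scale a (Lp_scale b u) = Lp_scale (a * b) u.
Proof.
elim/Lp_pi_ind: u => f.
by rewrite -(Lp_pi_scale b f) -(Lp_pi_scale a) -(Lp_pi_scale _ f) scalerA.
Qed.

Lemma Lp_scale1 : left_id 1 Lp_scale.
Proof. by elim/Lp_pi_ind=> f; rewrite -(Lp_pi_scale 1 f) scale1r. Qed.

Lemma Lp_scaleDr : right_distributive Lp_scale +%R.
Proof.
move=> a; elim/Lp_pi_ind=> f; elim/Lp_pi_ind=> g.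
rewrite -[\pi_Lp f + _](Lp_pi_add f g) -(Lp_pi_scale a f) -(Lp_pi_scale a g).
by rewrite -[RHS](Lp_pi_add (a *: f)) -(Lp_pi_scale a (f + g)) scalerDr.
Qed.

Lemma Lp_scaleDl u : {morph Lp_scale^~ u : a b / a + b}.
Proof.
elim/Lp_pi_ind: u => f a b /=.
rewrite -(Lp_pi_scale a f) -(Lp_pi_scale b f) -(Lp_pi_scale _ f).
by rewrite -[RHS](Lp_pi_add (a *: f)) scalerDl.
Qed.

HB.instance Definition _ := GRing.Zmodule_isLmodule.Build R Lp
  Lp_scaleA Lp_scale1 Lp_scaleDr Lp_scaleDl.

Definition Lp_nrm u : R := fine (Lp_norm mu p (Lp_repr u)).

Lemma Lp_reprP u : Lp_fun mu p (Lp_repr u).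
Proof. by apply/asboolP; exact: (Lp_valP (repr u)). Qed.

Lemma Lp_norm_fin u : Lp_norm mu p (Lp_repr u) \is a fin_num.
Proof.
have [_ /(Lp_norm_lty mu p1) h] := Lp_reprP u.
by rewrite ge0_fin_numE// Lnorm_ge0.
Qed.

Lemma Lp_repr_add u v :
  \forall x \ae mu, Lp_repr (u + v) x = (Lp_repr u + Lp_repr v) x.
Proof. exact: Lp_repr_pi. Qed.

Lemma Lp_repr_scale a u :
  \forall x \ae mu, Lp_repr (a *: u) x = (a *: Lp_repr u) x.
Proof. exact: Lp_repr_pi. Qed.

Lemma Lp_nrmD u v : Lp_nrm (u + v) <= Lp_nrm u + Lp_nrm v.
Proof.
rewrite -lee_fin EFinD !fineK ?Lp_norm_fin//.
rewrite (Lp_norm_ae_eq _ (Lp_repr_add u v)).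
by apply: Lp_normD => //; have [] := Lp_reprP u; have [] := Lp_reprP v.
Qed.

Lemma Lp_nrmZ a u : Lp_nrm (a *: u) = `|a| * Lp_nrm u.
Proof.
apply: EFin_inj; rewrite EFinM !fineK ?Lp_norm_fin//.
rewrite (Lp_norm_ae_eq _ (Lp_repr_scale a u)).
by apply: Lp_normZ => //; have [] := Lp_reprP u.
Qed.

Lemma Lp_nrm_eq0 u : Lp_nrm u = 0 -> u = 0.
Proof.
move=> u0; have [mu_ _] := Lp_reprP u.
have [g mg ug] := strongly_measurable_norm mu_.
have : Lp_norm mu p (Lp_repr u) = 0%E.
  by rewrite -[LHS]fineK ?Lp_norm_fin -?[fine _]/(Lp_nrm u) ?u0.
rewrite (Lp_norm_ae _ ug) => Ng0.
have p_gt0 : (0 < p%:E)%E by rewrite lte_fin (lt_le_trans _ p1).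
have mEg : measurable_fun setT (EFin \o g) by exact/measurable_EFinP.
have g0 := Lnorm_eq0_eq0 mEg p_gt0 Ng0.
rewrite -[u]reprK; apply/Lp_piP.
move: ug g0; apply: filterS2 => x ug /(_ I) /= [gx]; apply/eqP.
by rewrite -normr_eq0 [X in X == _]ug gx.
Qed.

HB.instance Definition _ :=
  Lmodule_isNormed.Build R Lp Lp_nrmD Lp_nrmZ Lp_nrm_eq0.

End Lp_space.

Section conditions.
Context {d : measure_display} {T : measurableType d} {R : realType}.
Context {X : completeNormedModType R}.
Variable mu : {finite_measure set T -> \bar R}.
Implicit Types (f s : T -> X) (H : set (T -> X)) (A E : set T).

Definition simple_integral E s : X :=
  \sum_(x \in range s) fine (mu (E `&` s @^-1` [set x])) *: x.

(* The limit is the same for all sequences of simple functions approximating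
   [f] in mean, and such a sequence exists as soon as [f] is strongly measurable
   with [`|f|] integrable; [get] only selects this limit. *)
Definition bochner_integral E f : X :=
  get [set v | exists s : (T -> X)^nat,
    [/\ forall n, simple_function (s n),
        (\int[mu]_x `|f x - s n x|%:E)%E @[n --> \oo] --> 0%E &
        simple_integral E (s n) @[n --> \oo] --> v]].

Definition integral_tight H := forall E, measurable E ->
  compact (closure [set bochner_integral E f | f in H]).

Definition p_uniformly_integrable (p : R) H := forall eps : R, 0 < eps ->
  \forall M \near +oo%R, forall f, H f ->
    (\int[mu]_(x in [set x | (M < `|f x| `^ p)%R]) (`|f x| `^ p)%:E <= eps%:E)%E.

(* [ereal_sup set0 = -oo], hence the maximum with [0]. *)
Definition ess_osc f A : \bar R :=
  ereal_inf [set maxe 0%E (ereal_sup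
      [set `|f w.1 - f w.2|%:E | w in (A `\` B) `*` (A `\` B)])
    | B in [set B | measurable B /\ mu B = 0%E]].

(* A finite partition of the whole space up to null sets: distinct members
   represent distinct classes, since they have positive measure and their
   intersection is null. The family is empty when [mu] is zero. *)
Definition finite_ae_partition (P : set (set T)) :=
  [/\ finite_set P,
      forall A, P A -> measurable A /\ (0 < mu A)%E,
      forall A B, P A -> P B -> A <> B -> mu (A `&` B) = 0%E &
      mu (~` \bigcup_(A in P) A) = 0%E].

Definition frechet_oscillation H := forall eps : R, 0 < eps ->
  exists2 P : set (set T), finite_ae_partition P &
    forall f, H f -> exists Of : set T,
      [/\ measurable Of, (mu (~` Of) <= eps%:E)%E &
          forall A, P A -> (ess_osc f (Of `&` A) <= eps%:E)%E].

End conditions.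

(* Main.v *)
Require Import Defs.
From mathcomp Require Import all_boot all_order all_algebra.
From mathcomp Require Import finmap generic_quotient.
From mathcomp Require Import all_classical all_reals all_analysis.
From mathcomp Require Import measurable_realfun ring lra.

(** Both directions go through functions that take finitely many values.

    Necessity. Simple functions are dense in the Lebesgue-Bochner space, by
    dominated convergence ([simple_function_dense]). Hence for each radius [r] a
    relatively compact set [H] stays within [r] of a finite set of simple
    functions ([compact_simple_net]). Each of these is bounded and constant on
    the cells of a common finite partition; the first fact gives uniform
    integrability and the second, with Markov's inequality, the oscillation
    condition. Tightness holds because integration over a measurable set is
    continuous into [X].

    Sufficiency. Uniform integrability truncates the members of [H] at a common
    height [M] at a small cost; the oscillation condition, with an [e] that is
    small with respect to [M], then puts each of them close in norm to some step
    function over one and the same finite partition ([uniform_step_approx]).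
    These step functions carry no compactness of their own, so they are replaced
    by cell averages: averaging contracts the norm, by Jensen's inequality, and
    fixes step functions, so that the average of [f] is at most twice as far
    from [f] as any step function ([step_cell_average_dist]). The averages
    depend only on the finitely many integrals of [f] over the cells, which
    tightness confines to compact sets. So every ultrafilter on the closure of
    [H] is Cauchy, and it converges because the space is complete
    ([Lp_complete]). *)

Set Implicit Arguments.
Unset Strict Implicit.
Unset Printing Implicit Defensive.
Import Order.TTheory GRing.Theory Num.Theory.
Import numFieldNormedType.Exports.
Local Open Scope classical_set_scope.
Local Open Scope ring_scope.

(** * Integrals of almost everywhere measurable nonnegative functions *)

Section ae_measurable.
Context {d : measure_display} {T : measurableType d} {R : realType}.
Variable mu : {finite_measure set T -> \bar R}.
Implicit Types u v w : T -> R.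

(** The measure is not complete, so the norm of a strongly measurable function
    is only almost everywhere equal to a measurable function. The integral of a
    nonnegative function does not see null sets, which makes this class as good
    as the measurable functions for monotonicity and additivity. *)
Definition ae_measurable u :=
  exists2 g : T -> R, measurable_fun setT g & \forall x \ae mu, u x = g x.

Lemma measurable_ae_measurable u : measurable_fun setT u -> ae_measurable u.
Proof. by move=> mu_; exists u => //; exact: aeW. Qed.

Lemma ae_measurableD u v : ae_measurable u -> ae_measurable v ->
  ae_measurable (fun x => u x + v x).
Proof.
move=> [g mg ug] [h mh vh]; exists (g \+ h); first exact: measurable_funD.
by move: ug vh; apply: filterS2 => x -> ->.
Qed.

Lemma ae_measurableM u v : ae_measurable u -> ae_measurable v ->
  ae_measurable (fun x => u x * v x).
Proof.
move=> [g mg ug] [h mh vh]; exists (g \* h); first exact: measurable_funM.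
by move: ug vh; apply: filterS2 => x -> ->.
Qed.

Lemma ae_measurable_cst (c : R) : ae_measurable (cst c).
Proof. exact: measurable_ae_measurable. Qed.

Lemma ae_measurable_indic (E : set T) : measurable E ->
  ae_measurable (\1_E : T -> R).
Proof. by move=> mE; apply: measurable_ae_measurable. Qed.

Lemma ae_measurable_comp (h : R -> R) u : measurable_fun setT h ->
  ae_measurable u -> ae_measurable (h \o u).
Proof.
move=> mh [g mg ug]; exists (h \o g); first exact: measurableT_comp.
by apply: filterS ug => x /= ->.
Qed.

Lemma ae_measurable_powR (p : R) u :
  ae_measurable u -> ae_measurable (fun x => u x `^ p).
Proof. by apply: (@ae_measurable_comp (fun x => x `^ p)). Qed.

(** The integral of an arbitrary nonnegative function is a supremum over the
    simple functions below it, hence monotone, and replacing [v] by [max u v]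
    changes [v] on a null set only. *)
Lemma ae_le_integral u v : (forall x, 0 <= u x) -> (forall x, 0 <= v x) ->
  (\forall x \ae mu, u x <= v x) ->
  (\int[mu]_x (u x)%:E <= \int[mu]_x (v x)%:E)%E.
Proof.
move=> u0 v0 uv.
have w0 x : (0 <= (Num.max (u x) (v x))%:E)%E by rewrite lee_fin le_max u0.
rewrite [leRHS](_ : _ = \int[mu]_x (Num.max (u x) (v x))%:E)%E; last first.
  apply: ge0_integral_ae => [x|//|]; first by rewrite lee_fin.
  by apply: filterS uv => x uv; rewrite max_r.
rewrite ge0_integralTE; last by move=> x; rewrite lee_fin.
rewrite ge0_integralTE//.
apply: ge_ereal_sup => _ [h hf <-]; apply: ereal_sup_ubound; exists h => // x.
by apply: (le_trans (hf x)); rewrite lee_fin le_max lexx.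
Qed.

Lemma ae_integralD u v : (forall x, 0 <= u x) -> (forall x, 0 <= v x) ->
  ae_measurable u -> ae_measurable v ->
  (\int[mu]_x (u x + v x)%:E = \int[mu]_x (u x)%:E + \int[mu]_x (v x)%:E)%E.
Proof.
move=> u0 v0 [g mg ug] [h mh vh].
have abs w w' : (forall x, 0 <= w x) -> (\forall x \ae mu, w x = w' x) ->
    (\int[mu]_x (w x)%:E = \int[mu]_x `|w' x|%:E)%E.
  move=> w0 ww'; apply: ge0_integral_ae => [x|x|]; rewrite ?lee_fin//.
  by apply: filterS ww' => x <-; rewrite ger0_norm.
rewrite (abs _ _ u0 ug) (abs _ _ v0 vh).
rewrite -ge0_integralD//; last 2 first.
- by apply/measurable_EFinP; exact: measurableT_comp.
- by apply/measurable_EFinP; exact: measurableT_comp.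
apply: ge0_integral_ae => [x|x|].
- by rewrite lee_fin addr_ge0.
- by rewrite adde_ge0// lee_fin.
by move: ug vh; apply: filterS2 => x <- <-; rewrite !ger0_norm// EFinD.
Qed.

Lemma ae_integralZ (k : R) u : 0 <= k -> (forall x, 0 <= u x) ->
  ae_measurable u ->
  (\int[mu]_x (k * u x)%:E = k%:E * \int[mu]_x (u x)%:E)%E.
Proof.
move=> k0 u0 [g mg ug].
have -> : (\int[mu]_x (u x)%:E = \int[mu]_x `|g x|%:E)%E.
  apply: ge0_integral_ae => [x|x|]; rewrite ?lee_fin//.
  by apply: filterS ug => x <-; rewrite ger0_norm.
rewrite -ge0_integralZl_EFin//; last first.
  by apply/measurable_EFinP; exact: measurableT_comp.
apply: ge0_integral_ae => [x|x|].
- by rewrite lee_fin mulr_ge0.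
- by rewrite -EFinM lee_fin mulr_ge0.
by apply: filterS ug => x <-; rewrite ger0_norm.
Qed.

Lemma ae_le_integralD u v w : (forall x, 0 <= u x) -> (forall x, 0 <= v x) ->
  (forall x, 0 <= w x) -> ae_measurable v -> ae_measurable w ->
  (\forall x \ae mu, u x <= v x + w x) ->
  (\int[mu]_x (u x)%:E <= \int[mu]_x (v x)%:E + \int[mu]_x (w x)%:E)%E.
Proof.
move=> u0 v0 w0 mv mw uvw; rewrite -ae_integralD//; apply: ae_le_integral => //.
by move=> x; rewrite addr_ge0.
Qed.

Lemma integral_indicE (E : set T) : measurable E ->
  (\int[mu]_x (\1_E x : R)%:E = mu E)%E.
Proof. by move=> mE; rewrite integral_indic// setIT. Qed.

Lemma integral_cstE (k : R) : (\int[mu]_(x in setT) k%:E = k%:E * mu setT)%E.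
Proof. by rewrite integral_cst. Qed.

End ae_measurable.

(** * Simple functions and their density *)

Section simple.
Context {d : measure_display} {T : measurableType d} {R : realType}.
Context {X : completeNormedModType R}.
Variable mu : {finite_measure set T -> \bar R}.
Implicit Types f g s t : T -> X.

Lemma strongly_measurableN f : strongly_measurable mu f ->
  strongly_measurable mu (- f).
Proof. by rewrite -scaleN1r; exact: strongly_measurableZ. Qed.

Lemma strongly_measurableB f g : strongly_measurable mu f ->
  strongly_measurable mu g -> strongly_measurable mu (f - g).
Proof.
by move=> mf mg; apply: strongly_measurableD => //; exact: strongly_measurableN.
Qed.

Lemma simple_strongly_measurable s : simple_function s ->
  strongly_measurable mu s.
Proof.
move=> ss; exists (fun=> s); split=> //.
by apply: aeW => x; exact: cvg_cst.
Qed.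

Lemma simple_functionN s : simple_function s -> simple_function (- s).
Proof. exact: simple_function_comp. Qed.

Lemma simple_functionB s t : simple_function s -> simple_function t ->
  simple_function (s - t).
Proof. by move=> ss st; apply: simple_functionD => //; exact: simple_functionN.
Qed.

Lemma simple_function_restrict (E : set T) s : measurable E ->
  simple_function s -> simple_function (fun x => if x \in E then s x else 0).
Proof.
move=> mE ss; apply: (simple_function_comp2 (fun y b => if b then y else 0) ss).
  exact: finite_finset.
case.
  rewrite (_ : _ @^-1` _ = E)//.
  by apply/seteqP; split => x /=; [exact: set_mem|exact: mem_set].
rewrite (_ : _ @^-1` _ = ~` E); first exact: measurableC.
apply/seteqP; split => x /=; last exact: memNset.
by move=> xE Ex; rewrite mem_set in xE.
Qed.

Lemma simple_function_bounded s : simple_function s ->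
  exists M : R, forall x, `|s x| <= M.
Proof.
move=> [/finite_seqP[r rs] _].
exists (\sum_(y <- r) `|y|) => x.
have : range s (s x) by exists x.
rewrite rs /= => h; rewrite (big_rem _ h) /= lerDl.
by apply: sumr_ge0.
Qed.

Lemma ae_measurable_norm f : strongly_measurable mu f ->
  ae_measurable mu (fun x => `|f x|).
Proof. exact: strongly_measurable_norm. Qed.

Lemma ae_measurable_normB f g : strongly_measurable mu f ->
  strongly_measurable mu g -> ae_measurable mu (fun x => `|f x - g x|).
Proof.
by move=> mf mg; exact: (ae_measurable_norm (strongly_measurableB mf mg)).
Qed.

Lemma ae_measurable_normBp (p : R) f g : strongly_measurable mu f ->
  strongly_measurable mu g -> ae_measurable mu (fun x => `|f x - g x| `^ p).
Proof.
by move=> mf mg; apply: ae_measurable_powR; exact: ae_measurable_normB.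
Qed.

Lemma Lp_fun_simple (p : R) s : 0 <= p -> simple_function s -> Lp_fun mu p s.
Proof.
move=> p0 ss; split; first exact: simple_strongly_measurable.
have [M sM] := simple_function_bounded ss.
apply: (@le_lt_trans _ _ (\int[mu]_(x in setT) (M `^ p)%:E)%E).
  apply: ae_le_integral => [x|x|]; rewrite ?powR_ge0//.
  apply: aeW => x; apply: ge0_ler_powR; rewrite ?nnegrE//.
  by apply: le_trans (sM x).
by rewrite integral_cst// ltey_eq fin_numM// fin_num_measure.
Qed.

End simple.

Lemma nbhs0_lte {R : realType} (e : R) : 0 < e ->
  nbhs 0%E [set y : \bar R | (y < e%:E)%E].
Proof.
move=> e0; apply: open_nbhs_nbhs; split; first exact: open_ereal_lt_ereal.
by rewrite /= lte_fin.
Qed.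

Lemma cvg_powR0 {R : realType} (p : R) (u : R^nat) : 0 < p ->
  (forall n, 0 <= u n) -> u n @[n --> \oo] --> 0 ->
  (u n `^ p) @[n --> \oo] --> 0.
Proof.
move=> p0 u0 /cvgr0Pnorm_lt ucvg; apply/cvgr0Pnorm_lt => e e0.
have := ucvg (e `^ p^-1) (powR_gt0 _ e0).
apply: filterS => n; rewrite !ger0_norm ?powR_ge0// => h.
rewrite -[ltRHS](powRr1 (ltW e0)) -(mulVf (lt0r_neq0 p0)) powRrM.
by apply: gt0_ltr_powR; rewrite ?nnegrE// powR_ge0.
Qed.

Section density.
Context {d : measure_display} {T : measurableType d} {R : realType}.
Context {X : completeNormedModType R}.
Variable mu : {finite_measure set T -> \bar R}.
Implicit Types f g s t : T -> X.

Lemma simple_function_comp_measurable (h : X -> R) s :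
  simple_function s -> measurable_fun setT (h \o s).
Proof.
move=> ss; have [fs ms] := simple_function_comp h ss.
move=> _ B mB; rewrite setTI.
rewrite (_ : _ @^-1` _ = \bigcup_(r in range (h \o s) `&` B)
    ((h \o s) @^-1` [set r])).
  by apply: fin_bigcup_measurable => //; exact: finite_setIl.
apply/seteqP; split => [x /= Bx|x [r [_ Br] /= ->]//].
by exists (h (s x)) => //; split => //; exists x.
Qed.

(** The simple functions [s n] that converge to [f] almost everywhere need not
    converge in mean. Cutting [s n] off where its norm exceeds twice that of [f]
    keeps the pointwise limit and makes [3 |f|] a dominating function, so that
    dominated convergence applies. *)
Lemma simple_function_dense (p : R) f : 0 < p -> Lp_fun mu p f ->
  forall e : R, 0 < e -> exists2 s, simple_function s &
    (\int[mu]_x (`|f x - s x| `^ p)%:E < e%:E)%E.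
Proof.
move=> p0 [mf f_fin] e e0; have [s [ss sf]] := mf.
have [g mg fg] := ae_measurable_norm mf.
pose E n := [set x | `|s n x| <= 2 * g x].
have mE n : measurable (E n).
  rewrite -[E n]setTI; apply: measurable_fun_ler => //.
    exact: (simple_function_comp_measurable Num.norm).
  exact: measurable_funM.
pose t n x := if x \in E n then s n x else 0.
have st n : simple_function (t n) by exact: simple_function_restrict.
have mft n := strongly_measurableB mf (simple_strongly_measurable mu (st n)).
have /choice[h hP] n : exists h : T -> R,
    measurable_fun setT h /\ \forall x \ae mu, `|f x - t n x| = h x.
  by have [h mh fh] := ae_measurable_norm (mft n); exists h.
have hft : \forall x \ae mu, forall n, `|f x - t n x| = h n x.
  apply: (ae_foralln (P := fun n x => `|f x - t n x| = h n x)) => n.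
  by case: (hP n).
have mhp n : measurable_fun setT (fun x => (`|h n x| `^ p)%:E).
  apply/measurable_EFinP.
  apply: (@measurableT_comp _ _ _ _ _ _ (fun x => x `^ p)) => //.
  by apply: measurableT_comp => //; case: (hP n).
have int3g : mu.-integrable setT (fun x => ((3 * `|g x|) `^ p)%:E).
  apply/integrableP; split.
    apply/measurable_EFinP.
    apply: (@measurableT_comp _ _ _ _ _ _ (fun x => x `^ p)) => //.
    by apply: measurable_funM => //; exact: measurableT_comp.
  rewrite (_ : (\int[mu]_x `|((3 * `|g x|) `^ p)%:E|)%E =
     (\int[mu]_x (3 `^ p * (`|f x| `^ p))%:E)%E).
    rewrite ae_integralZ ?powR_ge0//.
      by rewrite lte_mul_pinfty// lee_fin powR_ge0.
    by apply: ae_measurable_powR; exact: ae_measurable_norm.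
  apply: ge0_integral_ae => [x|x|].
  - exact: abse_ge0.
  - by rewrite lee_fin mulr_ge0// powR_ge0.
  apply: filterS fg => x fgx.
  by rewrite -powRM// -fgx normr_id abse_EFin ger0_norm ?powR_ge0.
have bnd x : `|f x| = g x -> forall n, `|f x - t n x| <= 3 * g x.
  move=> fgx n; rewrite /t; case: ifPn => [|_].
    rewrite inE /E /= => sg; apply: (le_trans (ler_normB _ _)).
    by rewrite fgx; lra.
  by rewrite subr0 fgx; have := normr_ge0 (f x); rewrite fgx; lra.
have tcvg : {ae mu, forall x, setT x ->
    (`|h n x| `^ p)%:E @[n --> \oo] --> cst 0%E x}.
  move: sf fg hft; apply: filterS3 => x sfx fgx hx _.
  apply: cvg_EFin; first by apply: nearW.
  rewrite /comp/=; apply: cvg_powR0 => //.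
  under eq_fun do rewrite -hx normr_id.
  apply/cvgr0Pnorm_lt => r r0.
  (* Where [f] vanishes, the cutoff forces [t n] to vanish as well. *)
  have [fx0|fx0] := eqVneq (f x) 0.
    near=> n; rewrite normr_id /t.
    case: ifPn => [|_]; last by rewrite fx0 subr0 normr0.
    rewrite inE /E /= -fgx fx0 normr0 mulr0 normr_le0 => /eqP ->.
    by rewrite subr0 normr0.
  near=> n; rewrite normr_id; have : `|f x - s n x| < Num.min r `|f x|.
    near: n; move/cvgrPdist_lt : sfx; apply.
    by rewrite lt_min r0 normr_gt0.
  rewrite lt_min => /andP[fr ff]; rewrite /t ifT// inE /E /= -fgx.
  rewrite -[s n x](subKr (f x)); apply: (le_trans (ler_normB _ _)); lra.
have bnd' : {ae mu, forall x n, setT x ->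
    (`|(`|h n x| `^ p)%:E| <= ((3 * `|g x|) `^ p)%:E)%E}.
  move: fg hft; apply: filterS2 => x fgx hx n _.
  rewrite abse_EFin lee_fin ger0_norm ?powR_ge0// -hx normr_id -fgx normr_id.
  apply: ge0_ler_powR; rewrite ?nnegrE ?mulr_ge0//; first exact: ltW.
  by rewrite fgx bnd.
have [_ + _] := dominated_convergence measurableT mhp (measurable_cst _) tcvg
  int3g bnd'.
have -> : [sequence (\int[mu]_x `|(`|h n x| `^ p)%:E - cst 0 x|)%E]_n =
    fun n => (\int[mu]_x (`|f x - t n x| `^ p)%:E)%E.
  apply/funext => n; apply: ge0_integral_ae => [x|x|].
  - exact: abse_ge0.
  - by rewrite lee_fin powR_ge0.
  apply: filterS (proj2 (hP n)) => x hx.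
  by rewrite sube0 -hx normr_id abse_EFin ger0_norm ?powR_ge0.
move=> lim0.
by have /lim0[n _ /(_ n (leqnn n)) tn] := nbhs0_lte e0; exists (t n).
Unshelve. all: by end_near. Qed.

End density.

(** * The integral of simple functions *)

Section simple_integral.
Context {d : measure_display} {T : measurableType d} {R : realType}.
Context {X : completeNormedModType R}.
Variable mu : {finite_measure set T -> \bar R}.
Variables (E : set T) (mE : measurable E).
Implicit Types f g s t : T -> X.

(** The integral may be computed from any measurable finite partition on whose
    cells the function is constant, not only from its own fibers. Applied to the
    common partition [t = (s, s')] it turns additivity into an identity between
    sums over the same index set. *)
Lemma simple_integral_comp (Y : choiceType) (t : T -> Y) (h : Y -> X) :
  finite_set (range t) -> (forall y, measurable (t @^-1` [set y])) ->
  simple_integral mu E (h \o t) =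
  \sum_(y <- fset_set (range t)) fine (mu (E `&` t @^-1` [set y])) *: h y.
Proof.
move=> ft mt.
have fht : finite_set (range (h \o t)).
  by rewrite -(image_comp t h); exact: finite_image.
have fiberE x : fine (mu (E `&` (h \o t) @^-1` [set x])) =
    \sum_(y <- fset_set (range t))
      fine (mu (E `&` t @^-1` [set y])) * (h y == x)%:R.
  apply: EFin_inj; rewrite fineK; last first.
    rewrite fin_num_measure//; apply: measurableI => //.
    rewrite (_ : _ @^-1` _ = \bigcup_(y in range t `&` h @^-1` [set x])
        t @^-1` [set y]).
      by apply: fin_bigcup_measurable => //; exact: finite_setIl.
    apply/seteqP; split => [z /= hz|z [y [_ /= hy] ->]]//.
    by exists (t z) => //; split => //; exists z.
  rewrite -sumEFin.
  rewrite (_ : E `&` _ = \bigcup_(y in range t)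
      (if h y == x then E `&` t @^-1` [set y] else set0)); last first.
    apply/seteqP; split => [z [Ez /= hz]|z [y _]].
      by exists (t z); [exists z|rewrite ifT//; exact/eqP].
    by case: eqP => // hy [Ez /= tz]; split => //=; rewrite tz.
  rewrite measure_fin_bigcup//; last 2 first.
  - move=> y y' _ _ [z []]; case: eqP => // _ [_ /= <-].
    by case: eqP => // _ [_ /= <-].
  - by move=> y _; case: eqP => // _; exact: measurableI.
  rewrite fsbig_finite//; apply: eq_bigr => y _; case: eqP => _.
    by rewrite mulr1 fineK// fin_num_measure//; exact: measurableI.
  by rewrite measure0 mulr0.
rewrite /simple_integral fsbig_finite//.
under eq_bigr do rewrite fiberE scaler_suml.
rewrite exchange_big/=; apply: eq_big_seq => y.
rewrite in_fset_set// inE => -[z _ tz].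
have hyr : h y \in fset_set (range (h \o t)).
  by rewrite in_fset_set// inE; exists z => //=; rewrite tz.
rewrite (bigD1_seq (h y)) ?fset_uniq//= eqxx mulr1 big1 ?addr0// => x xhy.
by rewrite eq_sym (negbTE xhy) mulr0 scale0r.
Qed.

Let simple_pair s t : simple_function s -> simple_function t ->
  finite_set (range (fun x => (s x, t x))) /\
  forall z, measurable ((fun x => (s x, t x)) @^-1` [set z]).
Proof. by move=> ss [? ?]; exact: simple_function_comp2. Qed.

Lemma simple_integralB s t : simple_function s -> simple_function t ->
  simple_integral mu E (s - t) =
  simple_integral mu E s - simple_integral mu E t.
Proof.
move=> ss st; have [fp mp] := simple_pair ss st.
rewrite -[s - t]/((fun y => y.1 - y.2) \o (fun x => (s x, t x))).
rewrite -[in X in X - _](_ : fst \o (fun x => (s x, t x)) = s)//.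
rewrite -[in X in _ - X](_ : snd \o (fun x => (s x, t x)) = t)//.
rewrite !simple_integral_comp// -sumrB; apply: eq_bigr => y _.
by rewrite scalerBr.
Qed.

Lemma simple_integral_cst (c : X) :
  simple_integral mu E (cst c) = fine (mu E) *: c.
Proof.
have [T0|/set0P T0] := eqVneq E set0.
  rewrite /simple_integral T0 measure0 scale0r fsbig1// => x _.
  by rewrite set0I measure0 scale0r.
have rT : range (cst tt : T -> unit) = [set tt].
  by case: T0 => z _; apply/seteqP; split => [[] //|[] _]; exists z.
have preT (y : unit) : (cst tt : T -> unit) @^-1` [set y] = setT.
  by case: y; apply/seteqP; split.
have -> : simple_integral mu E (cst c) =
    simple_integral mu E ((fun _ : unit => c) \o (cst tt : T -> unit)) by [].
rewrite simple_integral_comp//; last by move=> y; rewrite preT.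
by rewrite rT fset_set1 big_seq_fset1 preT setIT.
Qed.

Lemma simple_integral_norm s : simple_function s ->
  (`|simple_integral mu E s|%:E <= \int[mu]_x (`|s x| * \1_E x)%:E)%E.
Proof.
move=> [fs ms].
have -> : (\int[mu]_x (`|s x| * \1_E x)%:E = \int[mu]_x
    \sum_(y <- fset_set (range s)) (`|y| * \1_(E `&` s @^-1` [set y]) x)%:E)%E.
  apply: eq_integral => x _.
  have sx : s x \in fset_set (range s) by rewrite in_fset_set// inE; exists x.
  rewrite (bigD1_seq (s x)) ?fset_uniq//= big1 ?adde0 => [|y ysx].
    by rewrite !indicE in_setI (mem_set (_ : (s @^-1` [set s x]) x))// andbT.
  rewrite indicE memNset ?mulr0// => -[_ /= sxy].
  by move: ysx; rewrite sxy eqxx.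
have mI y : measurable (E `&` s @^-1` [set y]) by exact: measurableI.
rewrite ge0_integral_sum//; last first.
  by move=> y; apply/measurable_EFinP; exact: measurable_funM.
rewrite -[s in leLHS]/(id \o s) simple_integral_comp//.
apply: (@le_trans _ _ (\sum_(y <- fset_set (range s))
    (fine (mu (E `&` s @^-1` [set y])) * `|y|)%:E)%E).
  rewrite sumEFin lee_fin; apply: (le_trans (ler_norm_sum _ _ _)).
  apply: ler_sum => y _; rewrite normrZ ger0_norm//.
  by rewrite fine_ge0// measure_ge0.
apply: lee_sum => y _.
rewrite (ae_integralZ (mu := mu) (u := \1_(E `&` s @^-1` [set y])))//.
  by rewrite integral_indic// setIT muleC EFinM fineK// fin_num_measure.
exact: ae_measurable_indic.
Qed.

End simple_integral.

(** * The Bochner integral *)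

Lemma ler_dist_chain {R : numDomainType} {V : normedZmodType R} (v w a b : V) :
  `|v - w| <= `|v - a| + `|a - b| + `|b - w|.
Proof. by rewrite -addrA (le_trans (ler_distD a v w))// lerD2l ler_distD. Qed.

Section bochner.
Context {d : measure_display} {T : measurableType d} {R : realType}.
Context {X : completeNormedModType R}.
Variable mu : {finite_measure set T -> \bar R}.
Implicit Types (E : set T) (f g s t : T -> X).

(** On a finite measure space, because [t <= 1 + t ^ p]. *)
Lemma Lp_fun_L1 (p : R) f : 1 <= p -> Lp_fun mu p f -> Lp_fun mu 1 f.
Proof.
move=> p1 [mf f_fin]; split=> //.
apply: (@le_lt_trans _ _ (\int[mu]_x (cst (1 : R) x)%:E +
    \int[mu]_x (`|f x| `^ p)%:E)%E).
  apply: ae_le_integralD => //.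
  - exact: ae_measurable_cst.
  - by apply: ae_measurable_powR; exact: ae_measurable_norm.
  - apply: aeW => x; rewrite powRr1//; have [f1|f1] := leP `|f x| 1.
      by rewrite ler_wpDr// powR_ge0.
    by rewrite ler_wpDl// le1r_powR// ltW.
apply: lte_add_pinfty => //; rewrite [ltLHS](integral_cstE mu 1).
by rewrite ltey_eq fin_numM// fin_num_measure.
Qed.

Lemma dist_simple_integral E f s t : measurable E ->
  strongly_measurable mu f -> simple_function s -> simple_function t ->
  (`|simple_integral mu E s - simple_integral mu E t|%:E <=
   \int[mu]_x `|f x - s x|%:E + \int[mu]_x `|f x - t x|%:E)%E.
Proof.
move=> mE mf ss st; rewrite -simple_integralB//.
apply: (le_trans (simple_integral_norm mu mE (simple_functionB ss st))).
apply: ae_le_integralD => //.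
- by apply: ae_measurable_normB => //; exact: simple_strongly_measurable.
- by apply: ae_measurable_normB => //; exact: simple_strongly_measurable.
apply: aeW => x; apply: (@le_trans _ _ `|s x - t x|).
  by rewrite ler_piMr// indicE lern1 leq_b1.
by rewrite (distrC (f x) (s x)) ler_distD.
Qed.

Definition is_bochner_integral E f (v : X) := exists s : (T -> X)^nat,
  [/\ forall n, simple_function (s n),
      (\int[mu]_x `|f x - s n x|%:E)%E @[n --> \oo] --> 0%E &
      simple_integral mu E (s n) @[n --> \oo] --> v].

(** With [f = g] this is the independence of the approximating sequence; in
    general it is the basic norm estimate for the integral of [f - g]. *)
Lemma is_bochner_integral_le E f g v w : measurable E ->
  strongly_measurable mu f -> strongly_measurable mu g ->
  is_bochner_integral E f v -> is_bochner_integral E g w ->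
  (`|v - w|%:E <= \int[mu]_x (`|f x - g x| * \1_E x)%:E)%E.
Proof.
move=> mE mf mg [s [ss sf sv]] [t [st tg tw]].
apply/lee_addgt0Pr => e e0.
have e4 : 0 < e / 4 by rewrite divr_gt0.
have [n [vn wn fn gn]] : exists n, [/\
    `|v - simple_integral mu E (s n)| < e / 4,
    `|w - simple_integral mu E (t n)| < e / 4,
    (\int[mu]_x `|f x - s n x|%:E < (e / 4)%:E)%E &
    (\int[mu]_x `|g x - t n x|%:E < (e / 4)%:E)%E].
  near \oo => n; exists n; split; near: n.
  - by move/cvgrPdist_lt : sv; apply.
  - by move/cvgrPdist_lt : tw; apply.
  - exact: (sf _ (nbhs0_lte e4)).
  - exact: (tg _ (nbhs0_lte e4)).
have sm := simple_strongly_measurable mu (ss n).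
have tm := simple_strongly_measurable mu (st n).
have key : (`|simple_integral mu E (s n) - simple_integral mu E (t n)|%:E <=
    \int[mu]_x (`|f x - g x| * \1_E x)%:E + (\int[mu]_x `|f x - s n x|%:E
     + \int[mu]_x `|g x - t n x|%:E))%E.
  rewrite -simple_integralB//.
  have sB := simple_functionB (ss n) (st n).
  apply: (le_trans (simple_integral_norm mu mE sB)).
  rewrite -(ae_integralD (mu := mu) (u := fun x => `|f x - s n x|))//; first last.
  - exact: ae_measurable_normB.
  - exact: ae_measurable_normB.
  apply: ae_le_integralD => //.
  - apply: ae_measurableM; last exact: ae_measurable_indic.
    exact: ae_measurable_normB.
  - by apply: ae_measurableD; exact: ae_measurable_normB.
  apply: aeW => x.
  have h : `|s n x - t n x| <= `|f x - g x| + (`|f x - s n x| + `|g x - t n x|).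
    have := ler_dist_chain (s n x) (t n x) (f x) (g x).
    by rewrite (distrC (s n x) (f x)); lra.
  rewrite indicE; case: (x \in E); first by rewrite !mulr1.
  by rewrite !mulr0 add0r addr_ge0.
have : (`|v - w|%:E <= (e / 2)%:E +
  `|simple_integral mu E (s n) - simple_integral mu E (t n)|%:E)%E.
  rewrite -EFinD lee_fin.
  set a := simple_integral _ _ _ in vn *; set b := simple_integral _ _ _ in wn *.
  by have := ler_dist_chain v w a b; rewrite (distrC b w); lra.
move=> /le_trans; apply.
apply: (@le_trans _ _ ((e / 2)%:E + (\int[mu]_x (`|f x - g x| * \1_E x)%:E +
   ((e / 4)%:E + (e / 4)%:E)))%E).
  rewrite leeD2l//; apply: (le_trans key); rewrite leeD2l// leeD//; exact: ltW.
rewrite addeCA -!EFinD leeD2l// lee_fin; lra.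
Unshelve. all: by end_near. Qed.

Lemma is_bochner_integral_ex E f : measurable E -> Lp_fun mu 1 f ->
  exists v, is_bochner_integral E f v.
Proof.
move=> mE f1; have [mf _] := f1.
have /choice[s sP] n : exists s, simple_function s /\
    (\int[mu]_x `|f x - s x|%:E < n.+1%:R^-1%:E)%E.
  have n0 : 0 < n.+1%:R^-1 :> R by rewrite invr_gt0.
  have [s ss] := simple_function_dense (@ltr01 _) f1 n0.
  by under eq_integral do rewrite powRr1//; exists s.
have ss n := proj1 (sP n); have fs n := proj2 (sP n).
have : cvg (simple_integral mu E (s n) @[n --> \oo]).
  apply/cauchy_cvgP/cauchyP => e e0.
  have [n ne] : exists n, n.+1%:R^-1 < e / 2.
    near \oo => n; exists n; near: n.
    by apply: (cvgr_lt _ (@cvg_harmonic R)); rewrite divr_gt0.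
  exists (simple_integral mu E (s n)); exists n => // m /= nm.
  rewrite -ball_normE /ball_/= -lte_fin.
  apply: (le_lt_trans (dist_simple_integral mE mf (ss n) (ss m))).
  apply: (@lt_le_trans _ _ ((e / 2)%:E + (e / 2)%:E)%E).
    apply: lteD; first exact: (lt_trans (fs n)).
    apply: (lt_trans (fs m)); rewrite lte_fin; apply: le_lt_trans ne.
    by rewrite lef_pV2 ?posrE// ler_nat ltnS.
  by rewrite -EFinD -splitr.
move=> /cvg_ex[v sv]; exists v; exists s; split => //.
apply: (@squeeze_cvge _ _ _ _ (cst 0%E) _ (fun n => n.+1%:R^-1%:E)).
- by apply: nearW => n; rewrite integral_ge0//= ltW.
- exact: cvg_cst.
- by apply: cvg_EFin; [exact: nearW|exact: cvg_harmonic].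
Unshelve. all: by end_near. Qed.

Lemma bochner_integralP E f : measurable E -> Lp_fun mu 1 f ->
  is_bochner_integral E f (bochner_integral mu E f).
Proof.
move=> mE f1; have [v fv] := is_bochner_integral_ex mE f1.
exact: (getPex (ex_intro _ v fv)).
Qed.

Lemma le_dist_bochner_integral E f g : measurable E ->
  Lp_fun mu 1 f -> Lp_fun mu 1 g ->
  (`|bochner_integral mu E f - bochner_integral mu E g|%:E <=
    \int[mu]_x (`|f x - g x| * \1_E x)%:E)%E.
Proof.
move=> mE f1 g1; apply: is_bochner_integral_le => //.
- by case: f1.
- by case: g1.
- exact: bochner_integralP.
- exact: bochner_integralP.
Qed.

Lemma bochner_integral_cst E (c : X) : measurable E ->
  bochner_integral mu E (cst c) = fine (mu E) *: c.
Proof.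
move=> mE; have sc := simple_function_cst c.
have c1 : Lp_fun mu 1 (cst c) by exact: Lp_fun_simple.
have := @is_bochner_integral_le E _ _ _ (fine (mu E) *: c) mE (proj1 c1)
  (proj1 c1) (bochner_integralP mE c1).
have cc : is_bochner_integral E (cst c) (fine (mu E) *: c).
  exists (fun=> cst c); split => //.
  - under eq_fun do under eq_integral do rewrite subrr normr0.
    by under eq_fun do rewrite integral0; exact: cvg_cst.
  - by rewrite simple_integral_cst//; exact: cvg_cst.
move=> /(_ cc); under eq_integral do rewrite subrr normr0 mul0r.
by rewrite integral0 lee_fin normr_le0 subr_eq0 => /eqP.
Qed.

End bochner.

(** * Jensen's inequality for powers *)

Section jensen.
Context {d : measure_display} {T : measurableType d} {R : realType}.
Variable mu : {finite_measure set T -> \bar R}.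

(** The graph of [t |-> t ^ p] lies above its tangent at [a]: Young's inequality
    for [t] and [a ^ (p - 1)]. *)
Lemma powR_tangent (p a t : R) : 1 <= p -> 0 <= a -> 0 <= t ->
  p * a `^ (p - 1) * t <= (p - 1) * a `^ p + t `^ p.
Proof.
move=> p1 a0 t0; move: p1; rewrite le_eqVlt => /predU1P[<-|p1].
  by rewrite subrr powRr0 !mul1r mul0r add0r powRr1.
have p0 : 0 < p by lra.
have q0 : 0 < p / (p - 1) by rewrite divr_gt0//; lra.
have := @conjugate_powR R t (a `^ (p - 1)) p (p / (p - 1)) t0 (powR_ge0 _ _)
  p0 q0.
have p10 : p - 1 != 0 by rewrite subr_eq0 gt_eqF.
rewrite -powRrM (_ : (p - 1) * (p / (p - 1)) = p); last by field.
have pq : p^-1 + (p / (p - 1))^-1 = 1.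
  by field; rewrite p10 gt_eqF.
move=> /(_ pq); rewrite -(ler_pM2l p0) => h.
rewrite -mulrA (mulrC _ t); apply: (le_trans h).
rewrite le_eqVlt; apply/orP; left; apply/eqP.
by field; rewrite p10 gt_eqF.
Qed.

(** Integrate over [E] the tangent inequality at [a / mu E]. *)
Lemma jensen_powR (p a : R) (E : set T) (u : T -> R) : 1 <= p ->
  measurable E -> (0 < mu E)%E ->
  ae_measurable mu u -> (forall x, 0 <= u x) ->
  0 <= a -> (a%:E <= \int[mu]_x (u x * \1_E x)%:E)%E ->
  ((fine (mu E) * (a / fine (mu E)) `^ p)%:E <=
     \int[mu]_x (u x `^ p * \1_E x)%:E)%E.
Proof.
move=> p1 mE muE mu_ u0 a0 aint; set m := fine (mu E).
have muEm : mu E = m%:E by rewrite /m fineK// fin_num_measure.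
have m0 : 0 < m by rewrite -lte_fin -muEm.
set b := a / m; have b0 : 0 <= b by rewrite divr_ge0// ltW.
have k0 : 0 <= p * b `^ (p - 1) by rewrite mulr_ge0 ?powR_ge0//; lra.
have p10 : 0 <= (p - 1) * b `^ p by rewrite mulr_ge0 ?powR_ge0//; lra.
have mindic := ae_measurable_indic mu mE.
have : ((p * b `^ (p - 1))%:E * \int[mu]_x (u x * \1_E x)%:E <=
    (((p - 1) * b `^ p) * m)%:E + \int[mu]_x (u x `^ p * \1_E x)%:E)%E.
  rewrite -ae_integralZ//; last 2 first.
  - by move=> x; rewrite mulr_ge0.
  - exact: ae_measurableM.
  rewrite EFinM -muEm -(integral_indicE mu mE) -ae_integralZ//.
  apply: ae_le_integralD => //.
  - by move=> x; rewrite mulr_ge0// mulr_ge0.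
  - by move=> x; rewrite mulr_ge0.
  - by move=> x; rewrite mulr_ge0// powR_ge0.
  - by apply: ae_measurableM => //; exact: ae_measurable_cst.
  - by apply: ae_measurableM => //; exact: ae_measurable_powR.
  by apply: aeW => x; rewrite mulrA -mulrDl ler_wpM2r// powR_tangent.
have : ((p * b `^ (p - 1))%:E * a%:E <=
    (p * b `^ (p - 1))%:E * \int[mu]_x (u x * \1_E x)%:E)%E.
  by rewrite lee_pmul// lee_fin.
move=> /le_trans h /h; rewrite -EFinM.
have -> : p * b `^ (p - 1) * a = (p - 1) * b `^ p * m + m * b `^ p.
  have -> : a = b * m by rewrite /b divfK// gt_eqF.
  rewrite -(mulr_powRB1 b0 (_ : 0 < p)); [ring|lra].
by rewrite EFinD leeD2lE.
Qed.

End jensen.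

(** * Norm, dense subspace and completeness of the Lebesgue-Bochner space *)

Lemma cvg_powR {R : realType} (p a : R) (u : R^nat) : 0 < p ->
  (forall n, 0 <= u n) -> u n @[n --> \oo] --> a ->
  (u n `^ p) @[n --> \oo] --> a `^ p.
Proof.
move=> p0 u0 ua.
have : 0 <= a.
  rewrite -(cvg_lim _ ua)//; apply: limr_ge; last exact: nearW.
  by apply/cvg_ex; exists a.
rewrite le_eqVlt => /predU1P[a0|a0].
  by move: ua; rewrite -a0 powR0 ?gt_eqF//; exact: cvg_powR0.
apply: (cvg_comp u (fun x : R => x `^ p) ua).
suff : {for a, continuous (fun x : R => x `^ p)} by [].
apply: differentiable_continuous; apply/derivable1_diffP.
by apply: derivable_powR; rewrite in_itv/= a0.
Qed.

Section Lp_norm.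
Context {d : measure_display} {T : measurableType d} {R : realType}.
Variables (mu : {finite_measure set T -> \bar R}) (X : completeNormedModType R).
Variables (p : R) (p1 : 1 <= p).
Local Notation L := (Lp mu X p1).
Implicit Types (u v w : L) (f g : T -> X).

Let p0 : 0 < p. Proof. exact: lt_le_trans p1. Qed.

Lemma Lp_norm_powR u :
  ((`|u| `^ p)%:E = \int[mu]_x (`|Lp_repr u x| `^ p)%:E)%E.
Proof.
have -> : `|u| = fine (Lp_norm mu p (Lp_repr u)) by [].
rewrite -poweR_EFin fineK ?Lp_norm_fin// Lp_normE -poweRrM mulVf ?gt_eqF//.
rewrite poweRe1//.
by apply: integral_ge0 => x _; rewrite lee_fin powR_ge0.
Qed.

Lemma Lp_reprB u v :
  \forall x \ae mu, Lp_repr (u - v) x = Lp_repr u x - Lp_repr v x.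
Proof.
have Nv : \forall x \ae mu, Lp_repr (- v) x = - Lp_repr v x.
  exact: (Lp_repr_pi (- repr v)).
by apply: filterS2 (Lp_repr_add u (- v)) Nv => x -> <-.
Qed.

Lemma Lp_dist_powR u v : ((`|u - v| `^ p)%:E =
  \int[mu]_x (`|Lp_repr u x - Lp_repr v x| `^ p)%:E)%E.
Proof.
rewrite Lp_norm_powR; apply: ge0_integral_ae => [x|x|].
- by rewrite lee_fin powR_ge0.
- by rewrite lee_fin powR_ge0.
by apply: filterS (Lp_reprB u v) => x ->.
Qed.

Definition Lp_class f (Hf : Lp_fun mu p f) : L :=
  (\pi_(Lp mu X p1) (LpFun (asboolT Hf : f \in Lp_pred mu p1)))%qT.

Lemma Lp_repr_class f (Hf : Lp_fun mu p f) :
  \forall x \ae mu, Lp_repr (Lp_class Hf) x = f x.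
Proof. exact: Lp_repr_pi. Qed.

Lemma Lp_dist_class u f (Hf : Lp_fun mu p f) : ((`|u - Lp_class Hf| `^ p)%:E =
  \int[mu]_x (`|Lp_repr u x - f x| `^ p)%:E)%E.
Proof.
rewrite Lp_dist_powR; apply: ge0_integral_ae => [x|x|].
- by rewrite lee_fin powR_ge0.
- by rewrite lee_fin powR_ge0.
by apply: filterS (Lp_repr_class Hf) => x ->.
Qed.

Lemma Lp_class_dist_class f g (Hf : Lp_fun mu p f) (Hg : Lp_fun mu p g) :
  ((`|Lp_class Hf - Lp_class Hg| `^ p)%:E =
   \int[mu]_x (`|f x - g x| `^ p)%:E)%E.
Proof.
rewrite Lp_dist_class; apply: ge0_integral_ae => [x|x|].
- by rewrite lee_fin powR_ge0.
- by rewrite lee_fin powR_ge0.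
by apply: filterS (Lp_repr_class Hf) => x ->.
Qed.

Lemma ltr_powR_base (a b : R) : 0 <= a -> 0 <= b -> (a `^ p < b `^ p) = (a < b).
Proof.
move=> a0 b0; apply/idP/idP; last by apply: gt0_ltr_powR; rewrite ?nnegrE.
by apply: contraTT; rewrite -!leNgt; apply: ge0_ler_powR; rewrite ?nnegrE// ltW.
Qed.

Lemma ler_powR_base (a b : R) : 0 <= a -> 0 <= b ->
  (a `^ p <= b `^ p) = (a <= b).
Proof. by move=> a0 b0; rewrite !leNgt ltr_powR_base. Qed.

Lemma Lp_funD f g : Lp_fun mu p f -> Lp_fun mu p g -> Lp_fun mu p (f + g).
Proof.
move=> /asboolT Hf /asboolT Hg; apply/asboolP.
exact: (rpredD (Hf : f \in Lp_pred mu p1) (Hg : g \in Lp_pred mu p1)).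
Qed.

(** Quantified over [Hs] because a class carries a proof that its representative
    has finite norm, and different users supply different proofs. *)
Lemma Lp_simple_dense u (e : R) : 0 < e ->
  exists2 s, simple_function s &
    forall Hs : Lp_fun mu p s, `|u - Lp_class Hs| < e.
Proof.
move=> e0.
have [s ss se] := simple_function_dense p0 (Lp_reprP u) (powR_gt0 p e0).
exists s => // Hs; rewrite -ltr_powR_base ?(ltW e0)//.
by rewrite -lte_fin Lp_dist_class.
Qed.

(** The embedding into the integrable functions is uniformly continuous, by
    Jensen's inequality on the whole space. *)
Lemma Lp_small_L1_small (e : R) : 0 < e -> exists2 r : R, 0 < r &
  forall f, strongly_measurable mu f ->
    (\int[mu]_x (`|f x| `^ p)%:E < (r `^ p)%:E)%E ->
    (\int[mu]_x `|f x|%:E < e%:E)%E.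
Proof.
move=> e0; have [mT0|mT0] := eqVneq (mu setT) 0%E.
  exists 1 => // f _ _.
  rewrite (_ : \int[mu]_x `|f x|%:E = \int[mu]_x (0 : R)%:E)%E.
    by rewrite integral0 lte_fin.
  by apply: ge0_integral_ae => //; exists setT; split.
have mTgt0 : (0 < mu setT)%E by rewrite lt0e mT0 measure_ge0.
set m := fine (mu setT).
have m0 : 0 < m by rewrite -lte_fin /m fineK// fin_num_measure.
have k0 : 0 < m * (e / m) `^ p by rewrite mulr_gt0// powR_gt0// divr_gt0.
exists ((m * (e / m) `^ p) `^ p^-1); first by rewrite powR_gt0.
move=> f mf; rewrite -powRrM mulVf ?gt_eqF// powRr1 ?ltW//.
apply: contraTT; rewrite -!leNgt => h.
have := @jensen_powR _ _ _ mu p e setT (fun x => `|f x|) p1 measurableT mTgt0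
  (ae_measurable_norm mf) (fun=> normr_ge0 _) (ltW e0).
have T1 (u : T -> R) :
    (\int[mu]_x (u x * \1_[set: T] x)%:E = \int[mu]_x (u x)%:E)%E.
  by apply: eq_integral => x _; rewrite indicT mulr1.
by rewrite !T1; apply.
Qed.

(** Riesz-Fischer. Pick simple functions [S n] that are centers of balls in the
    filter, of radius at most [eps n] and so small that the norms of the
    consecutive differences have summable integrals. Then the telescoping series
    converges absolutely almost everywhere, and the limit of [S n] is strongly
    measurable by definition, because the [S n] are simple. Fatou's lemma shows
    that it is the limit in norm. *)
Lemma Lp_complete (F : set_system L) : ProperFilter F -> cauchy_ex F ->
  exists u, F --> u.
Proof.
move=> FF Fcauchy.
pose eps n : R := 1 / (2 ^ n.+1)%:R.
have eps0 n : 0 < eps n by rewrite divr_gt0// ltr0n expn_gt0.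
have epsS n : eps n.+1 = eps n / 2.
  by rewrite /eps expnS natrM invfM; ring.
have eps_le n m : (n <= m)%N -> eps m <= eps n.
  elim: m => [|m ih]; first by rewrite leqn0 => /eqP ->.
  rewrite leq_eqVlt => /predU1P[->//|]; rewrite ltnS => /ih; apply: le_trans.
  by rewrite epsS; have := eps0 m; lra.
have /choice[r rP] n : exists r : R, 0 < r /\
    forall f, strongly_measurable mu f ->
    (\int[mu]_x (`|f x| `^ p)%:E < (r `^ p)%:E)%E ->
    (\int[mu]_x `|f x|%:E < (eps n)%:E)%E.
  by have [r r0 rP] := Lp_small_L1_small (eps0 n); exists r.
pose cls s (ss : simple_function s) := Lp_class (Lp_fun_simple mu (ltW p0) ss).
have /choice[s sP] n : exists s : {s : T -> X | simple_function s},
    F (ball (cls _ (proj2_sig s)) (Num.min (r n) (eps n))).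
  have q0 : 0 < Num.min (r n) (eps n) / 2.
    by rewrite divr_gt0// lt_min (proj1 (rP n)) eps0.
  have [u Fu] := Fcauchy _ q0.
  have [s ss us] := Lp_simple_dense u q0.
  exists (exist _ s ss); apply: filterS Fu => v.
  rewrite -!ball_normE /ball_/= => uv.
  rewrite (splitr (Num.min _ _)); apply: le_lt_trans (ler_distD u _ _) _.
  by rewrite ltrD// distrC us.
pose S n : T -> X := proj1_sig (s n).
pose ss n : simple_function (S n) := proj2_sig (s n).
have mS n := simple_strongly_measurable mu (ss n).
pose U n := cls _ (ss n).
have FU n : F (ball (U n) (Num.min (r n) (eps n))) by exact: sP.
have dist_eps n :
    (\int[mu]_x `|S n.+1 x - S n x|%:E <= (2 / (2 ^ n.+1)%:R)%:E)%E.
  have [w [wn wn1]] := filter_ex (filterI (FU n) (FU n.+1)).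
  have L1 k : ball (U k) (Num.min (r k) (eps k)) w ->
      (\int[mu]_x `|Lp_repr w x - S k x|%:E < (eps k)%:E)%E.
    rewrite -ball_normE /ball_/= lt_min => /andP[wk _].
    have E := Lp_dist_class w (Lp_fun_simple mu (ltW p0) (ss k)).
    apply: (proj2 (rP k) (Lp_repr w - S k)).
      by apply: strongly_measurableB => //; have [] := Lp_reprP w.
    have [rk0 _] := rP k.
    by rewrite -[ltLHS]E lte_fin ltr_powR_base ?(ltW rk0)// distrC.
  apply: (@le_trans _ _ (\int[mu]_x `|Lp_repr w x - S n x|%:E +
      \int[mu]_x `|Lp_repr w x - S n.+1 x|%:E)%E).
    have [mw _] := Lp_reprP w.
    apply: ae_le_integralD => //; [exact: ae_measurable_normB..|].
    apply: aeW => x; have := ler_distD (Lp_repr w x) (S n.+1 x) (S n x).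
    by rewrite (distrC (S n.+1 x) (Lp_repr w x)); lra.
  apply: (le_trans (leeD (ltW (L1 _ wn)) (ltW (L1 _ wn1)))).
  rewrite -EFinD lee_fin epsS [leRHS](_ : _ = 2 * eps n).
    by have := eps0 n; lra.
  by rewrite /eps; ring.
have dist_U n m : (n <= m)%N -> `|U m - U n| <= 2 * eps n.
  move=> nm; have [w [wn wm]] := filter_ex (filterI (FU n) (FU m)).
  move: wn wm; rewrite -!ball_normE /ball_/= !lt_min => /andP[_ wn] /andP[_ wm].
  apply: (le_trans (ler_distD w _ _)); rewrite (distrC w).
  by have := eps_le _ _ nm; lra.
have mSp n m : measurable_fun setT (fun x => `|S m x - S n x| `^ p).
  apply: (simple_function_comp_measurable (fun y => `|y| `^ p)).
  exact: simple_functionB.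
have mSn n : measurable_fun setT (fun x => `|S n.+1 x - S n x|%:E).
  apply/measurable_EFinP.
  exact: (simple_function_comp_measurable Num.norm
    (simple_functionB (ss n.+1) (ss n))).
have S_cvg : {ae mu, forall x, setT x -> cvgn (S ^~ x)}.
  have h : mu.-integrable setT (fun x => \sum_(n <oo) `|S n.+1 x - S n x|%:E)%E.
    apply/integrableP; split.
      by apply: ge0_emeasurable_sum => // k x _ _; rewrite lee_fin.
    under eq_integral do rewrite gee0_abs ?nneseries_ge0//.
    rewrite integral_nneseries//.
    apply: (@le_lt_trans _ _ (\sum_(n <oo) (2 / (2 ^ n.+1)%:R)%:E)%E).
      by apply: lee_nneseries => // n _ _; exact: integral_ge0.
    by apply: (le_lt_trans (epsilon_trick0 _ _)) => //; rewrite ltry.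
  apply: filterS (integrable_ae measurableT h) => x /(_ I) hx _.
  pose t := telescope (S ^~ x).
  have tcvg : cvgn (series t).
    apply: normed_cvg; apply: nondecreasing_is_cvgn.
      by apply: nondecreasing_series => k; rewrite normr_ge0.
    exists (fine (\sum_(n <oo) `|S n.+1 x - S n x|%:E)%E) => _ [k _ <-].
    rewrite -lee_fin fineK// [X in (X%:E <= _)%E]/series /= -sumEFin.
    by apply: (nneseries_lim_ge k) => *; rewrite lee_fin.
  rewrite (_ : S ^~ x = (fun n => S 0%N x + series t n)).
    by apply: is_cvgD => //; exact: is_cvg_cst.
  by apply/funext => n; rewrite -eq_sum_telescope.
pose f x := limn (S ^~ x).
have Sf : \forall x \ae mu, S n x @[n --> \oo] --> f x.
  by apply: filterS S_cvg => x /(_ I).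
have mf : strongly_measurable mu f by exists S.
have fS n : (\int[mu]_x (`|f x - S n x| `^ p)%:E <= ((2 * eps n) `^ p)%:E)%E.
  apply: (@le_trans _ _
      (\int[mu]_x (limn_einf (fun m => (`|S m x - S n x| `^ p)%:E)))%E).
    apply: ge0_integral_ae_le => [x|x|].
    - by rewrite lee_fin powR_ge0.
    - rewrite limn_einf_lim; apply: lime_ge; first exact: is_cvg_einfs.
      apply: nearW => k; apply: le_ereal_inf_tmp => _ [l _ <-].
      by rewrite lee_fin powR_ge0.
    apply: filterS Sf => x Sfx; apply/esym.
    apply: (cvg_limn_einf_sup (_ : _ --> _)).1.
    apply: cvg_EFin; first exact: nearW.
    apply: cvg_powR => //; apply: cvg_norm; apply: cvgB => //.
    exact: cvg_cst.
  apply: (le_trans (fatou mu measurableT _ _)).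
  - by move=> m; apply/measurable_EFinP.
  - by move=> m x _; rewrite lee_fin powR_ge0.
  rewrite limn_einf_lim; apply: lime_le; first exact: is_cvg_einfs.
  apply: nearW => k; pose m := maxn k n.
  apply: (@le_trans _ _ (\int[mu]_x (`|S m x - S n x| `^ p)%:E)%E).
    by apply: ereal_inf_lbound; exists m => //=; rewrite leq_maxl.
  rewrite -(Lp_class_dist_class (Lp_fun_simple mu (ltW p0) (ss m))
    (Lp_fun_simple mu (ltW p0) (ss n))) lee_fin ler_powR_base//; last first.
    by rewrite mulr_ge0// ltW.
  by apply: dist_U; rewrite leq_maxr.
have Hf : Lp_fun mu p f.
  rewrite -(subrK (S 0%N) f); apply: Lp_funD;
    last exact: (Lp_fun_simple mu (ltW p0)).
  split; first exact: strongly_measurableB.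
  exact: (le_lt_trans (fS 0%N) (ltry _)).
pose u := Lp_class Hf.
have uU n : `|u - U n| <= 2 * eps n.
  have e2 : 0 <= 2 * eps n by rewrite mulr_ge0// ltW.
  by rewrite -ler_powR_base// -lee_fin Lp_class_dist_class; exact: fS.
exists u; apply/cvgrPdist_lt => e e0.
have [n ne] : exists n, eps n < e / 3.
  have eps_cvg : eps n @[n --> \oo] --> 0.
    have -> : eps = geometric 2^-1 2^-1.
      apply/funext => n; rewrite /eps /= natrX div1r exprS invfM exprVn.
      by [].
    by apply: cvg_geometric; rewrite ger0_norm// invf_lt1// ltr1n.
  near \oo => n; exists n; near: n.
  by apply: (cvgr_lt _ eps_cvg); rewrite divr_gt0.
apply: filterS (FU n) => v; rewrite -ball_normE /ball_/= lt_min => /andP[_ vn].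
have := ler_distD (U n) u v; have := uU n; lra.
Unshelve. all: by end_near. Qed.

End Lp_norm.

(** * Relatively compact sets satisfy the three conditions *)

Section refine.
Context {d : measure_display} {T : measurableType d} {R : realType}.
Context {X : completeNormedModType R}.
Variable mu : {finite_measure set T -> \bar R}.

(** The map [t] lists the values of the members of [D]; its fibers are the cells
    of their common refinement. *)
Lemma simple_common_refinement (D : set (T -> X)) : finite_set D ->
  (forall s, D s -> simple_function s) ->
  exists t : T -> seq X, [/\ finite_set (range t),
    forall y, measurable (t @^-1` [set y]) &
    forall s, D s -> forall x x', t x = t x' -> s x = s x'].
Proof.
move=> /finite_seqP[r ->]; elim: r => [|s r ih] Dsimple.
  exists (cst [::]); split=> //.
  by move=> y; rewrite preimage_cst; case: ifP.
have [|t [ft mt tr]] := ih.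
  by move=> s' rs'; apply: Dsimple; rewrite /= in_cons rs' orbT.
have ss : simple_function s by apply: Dsimple; rewrite /= mem_head.
have [fst mst] := simple_function_comp2 cons ss ft mt.
exists (fun x => s x :: t x); split => // s' /= + x x' [sx tx].
by rewrite in_cons => /predU1P[->//|/tr]; apply.
Qed.

(** Fibers of measure zero are discarded, since the members of a partition have
    positive measure; finitely many of them still form a null set. *)
Lemma fibers_ae_partition (Y : choiceType) (t : T -> Y) :
  finite_set (range t) -> (forall y, measurable (t @^-1` [set y])) ->
  finite_ae_partition mu
    ([set t @^-1` [set y] | y in range t] `&` [set A | (0 < mu A)%E]).
Proof.
move=> ft mt; split.
- exact/finite_setIl/finite_image.
- by move=> A [[y _ <-]].
- move=> _ _ [[y _ <-] _] [[z _ <-] _] yz.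
  rewrite (_ : _ `&` _ = set0) ?measure0// -subset0 => x [/= xy xz].
  by apply: yz; rewrite -xy -xz.
pose N := range t `&` [set y | mu (t @^-1` [set y]) = 0%E].
rewrite (_ : ~` _ = \bigcup_(y in N) (t @^-1` [set y])).
  rewrite measure_fin_bigcup//; first by apply: fsbig1 => y [].
    exact: finite_setIl.
  by move=> y z _ _ [x [<- <-]].
apply/seteqP; split => [x /= xP|x [y [_ /= y0] xy]].
  exists (t x) => //; split; first by exists x.
  apply/eqP; apply: contra_notT xP => tx.
  exists (t @^-1` [set t x]) => //.
  split; last by rewrite /= lt0e tx measure_ge0.
  by exists (t x) => //; exists x.
by move=> [_ [[z _ <-] /= z0] /= xz]; move: z0; rewrite -xz xy y0 ltxx.
Qed.

End refine.

Lemma norm_continuous {R : realType} {V W : normedModType R} (f : V -> W) :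
  (forall (u : V) (e : R), 0 < e -> exists2 r : R, 0 < r &
    forall v, `|u - v| < r -> `|f u - f v| < e) -> continuous f.
Proof.
move=> fP u; apply/cvgrPdist_lt => e /(fP u)[r r0 rP].
apply: filterS (nbhsx_ballx u r r0) => v; rewrite -ball_normE; exact: rP.
Qed.

Section necessity.
Context {d : measure_display} {T : measurableType d} {R : realType}.
Variables (mu : {finite_measure set T -> \bar R}) (X : completeNormedModType R).
Variables (p : R) (p1 : 1 <= p).
Local Notation L := (Lp mu X p1).
Implicit Types (H : set L).

Let p0 : 0 < p. Proof. exact: lt_le_trans p1. Qed.

(** Balls centered at simple functions cover the space by density; finitely many
    of them cover [H]. *)
Lemma compact_simple_net H : compact (closure H) -> forall r : R, 0 < r ->
  exists D : set (T -> X),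
  [/\ finite_set D, forall s, D s -> simple_function s &
    forall u, H u -> exists2 s, D s &
      (\int[mu]_x (`|Lp_repr u x - s x| `^ p)%:E < (r `^ p)%:E)%E].
Proof.
rewrite compact_cover => Hc r r0.
pose S := [set v : L | exists s (ss : simple_function s),
  v = Lp_class p1 (Lp_fun_simple mu (ltW p0) ss)].
have [||D' D'S Hcov] := Hc L S (fun v => ball v r).
- by move=> v _; exact: ball_open.
- move=> u _; have [s ss us] := Lp_simple_dense u r0.
  exists (Lp_class p1 (Lp_fun_simple mu (ltW p0) ss)); first by exists s, ss.
  by rewrite -ball_normE /ball_/= distrC us.
have /choice[g gP] (v : L) : exists s, S v -> exists ss : simple_function s,
    v = Lp_class p1 (Lp_fun_simple mu (ltW p0) ss).
  have [[s hs]|nS] := pselect (S v); first by exists s.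
  by exists 0.
exists (g @` [set` D']); split.
- exact/finite_image/finite_fset.
- by move=> _ [v /= /D'S/set_mem Sv <-]; have [] := gP v Sv.
move=> u Hu; have [v /= vD' uv] := Hcov _ (subset_closure Hu).
exists (g v); first by exists v.
have [ss vE] := gP v (set_mem (D'S _ vD')).
have := Lp_dist_class u (Lp_fun_simple mu (ltW p0) ss); rewrite -vE => <-.
rewrite lte_fin ltr_powR_base// ?(ltW r0)//.
by move: uv; rewrite -ball_normE /ball_/= distrC.
Qed.

Lemma bochner_integral_continuous (E : set T) : measurable E ->
  continuous (fun u : L => bochner_integral mu E (Lp_repr u)).
Proof.
move=> mE; apply: norm_continuous => u e e0.
have [r r0 rP] := @Lp_small_L1_small _ _ _ mu X _ p1 _ e0.
exists r => // v uv.
have [[mu_ fu] [mv fv]] := (Lp_reprP u, Lp_reprP v).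
rewrite -lte_fin; apply: le_lt_trans (le_dist_bochner_integral mE _ _) _.
- exact: Lp_fun_L1 (Lp_reprP u).
- exact: Lp_fun_L1 (Lp_reprP v).
apply: (@le_lt_trans _ _ (\int[mu]_x `|(Lp_repr u - Lp_repr v) x|%:E)%E).
  apply: ae_le_integral => //.
  by apply: aeW => x; rewrite ler_piMr// indicE lern1 leq_b1.
apply: rP; first exact: strongly_measurableB.
by rewrite -[ltLHS](Lp_dist_powR u v) lte_fin ltr_powR_base// ltW.
Qed.

Lemma compact_integral_tight H : compact (closure H) ->
  integral_tight mu [set Lp_repr f | f in H].
Proof.
move=> cH E mE; rewrite image_comp.
have cont := bochner_integral_continuous mE.
have cK :
    compact ((fun u : L => bochner_integral mu E (Lp_repr u)) @` closure H).
  by apply: continuous_compact => //; exact: continuous_subspaceT.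
apply: (subclosed_compact _ cK); first exact: closed_closure.
have /closure_id -> := compact_closed (@norm_hausdorff _ X) cK.
by apply: closure_subset; apply: image_subset; exact: subset_closure.
Qed.

(** Let [M0] bound the simple functions of a finite net. Where [|f| > 2 M0], the
    function [s] of the net next to [f] satisfies [|s| <= |f| / 2], so that [|f|]
    is at most [2 |f - s|]: the tails of [f] are controlled by its distance to
    [s]. *)
Lemma compact_p_uniformly_integrable H : compact (closure H) ->
  p_uniformly_integrable mu p [set Lp_repr f | f in H].
Proof.
move=> cH e e0; pose r := e `^ p^-1 / 2.
have r0 : 0 < r by rewrite divr_gt0// powR_gt0.
have [D [fD sD HD]] := compact_simple_net cH r0.
have [M0 M0P] : exists M0 : R, forall s, D s -> forall x, `|s x| <= M0.
  move: fD sD => /finite_seqP[ss ->]; elim: ss => [|s ss ih] sD.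
    by exists 0.
  have [|M1 M1P] := ih.
    by move=> s' rs'; apply: sD; rewrite /= in_cons rs' orbT.
  have [|M2 M2P] := @simple_function_bounded _ _ _ _ s.
    by apply: sD; rewrite /= mem_head.
  exists (Num.max M1 M2) => s' /=; rewrite in_cons => /predU1P[->|s's] x.
    by rewrite le_max M2P orbT.
  by rewrite le_max M1P.
exists ((2 * `|M0|) `^ p); split; first exact: num_real.
move=> M MM0 _ [u Hu <-]; have [s Ds us] := HD u Hu.
rewrite integral_mkcond.
apply: (@le_trans _ _ ((2 `^ p)%:E *
    \int[mu]_x (`|Lp_repr u x - s x| `^ p)%:E)%E).
  rewrite -ae_integralZ ?powR_ge0//; last first.
    apply: ae_measurable_normBp; first by have [] := Lp_reprP u.
    exact/simple_strongly_measurable/sD.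
  set f := Lp_repr u; set A := [set x | M < `|f x| `^ p].
  rewrite [leLHS](_ : _ =
      \int[mu]_x (if x \in A then `|f x| `^ p else 0)%:E)%E; last first.
    by apply: eq_integral => x _; rewrite patchE; case: ifP.
  apply: ae_le_integral => [x|x|].
  - by case: ifP => // _; exact: powR_ge0.
  - by rewrite mulr_ge0// powR_ge0.
  apply: aeW => x; case: ifPn => [|_]; last by rewrite mulr_ge0// powR_ge0.
  rewrite inE /A /= => /(lt_trans MM0); rewrite ltr_powR_base// => fx.
  rewrite -powRM// ler_powR_base//.
  have sM := le_trans (M0P s Ds x) (ler_norm M0).
  by have := ler_normB (f x - s x) (- s x); rewrite opprK subrK normrN; lra.
apply: (le_trans (lee_wpmul2l _ (ltW us))); first by rewrite lee_fin powR_ge0.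
rewrite -EFinM lee_fin -powRM ?(ltW r0)// /r mulrCA divff// mulr1 -powRrM.
by rewrite mulVf ?gt_eqF// powRr1// ltW.
Qed.

(** Take the common refinement of a finite net of simple functions. Each [f] is
    within [e / 2] of some [s] of the net outside a small set, by Markov's
    inequality, and [s] is constant on the cells. *)
Lemma compact_frechet_oscillation H : compact (closure H) ->
  frechet_oscillation mu [set Lp_repr f | f in H].
Proof.
move=> cH e e0; have e20 : 0 < e / 2 by rewrite divr_gt0.
(* If the integral of [|f - s| ^ p] is below this number, then [|f - s| > e / 2]
   holds on a set of measure at most [e]. *)
have k0 : 0 < e * (e / 2) `^ p by rewrite mulr_gt0// powR_gt0.
have [D [fD sD HD]] := compact_simple_net cH (powR_gt0 p^-1 k0).
have [t [ft mt tD]] := simple_common_refinement fD sD.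
have Ppart := fibers_ae_partition mu ft mt.
eexists; first exact: Ppart.
move=> _ [u Hu <-]; have [s Ds us] := HD u Hu.
have [mfu _] := Lp_reprP u.
have ms := simple_strongly_measurable mu (sD s Ds).
have [g mg [B [mB B0 gB]]] := ae_measurable_normB mfu ms.
have mO : measurable [set x | g x <= e / 2].
  by rewrite -[X in measurable X]setTI; exact: measurable_fun_ler.
have mOC := measurableC mO.
exists [set x | g x <= e / 2]; split => //.
  have : (((e / 2) `^ p)%:E * mu (~` [set x | (g x <= e / 2)%R]) <=
      \int[mu]_x (`|Lp_repr u x - s x| `^ p)%:E)%E.
    rewrite -(integral_indicE mu mOC) -ae_integralZ ?powR_ge0//; last first.
      exact: ae_measurable_indic.
    apply: ae_le_integral => [x|x|].
    - by rewrite mulr_ge0// powR_ge0.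
    - exact: powR_ge0.
    exists B; split => // x /=; apply: contra_notP => Bx.
    have /contrapT gx : ~ ~ (`|Lp_repr u x - s x| = g x) by move/gB.
    rewrite indicE; case: (boolP (x \in _)) => [|_];
      last by rewrite mulr0 powR_ge0.
    rewrite inE mulr1 gx /= => /negP; rewrite -ltNge => eg.
    have gx0 := lt_trans e20 eg.
    by rewrite ler_powR_base ?(ltW e20) ?(ltW gx0) ?(ltW eg).
  move=> /le_lt_trans /(_ us).
  rewrite -powRrM mulVf ?gt_eqF// powRr1 ?(ltW k0)//.
  rewrite -[mu _]fineK ?fin_num_measure// -EFinM lte_fin lee_fin mulrC => h.
  by apply: ltW; rewrite -(ltr_pM2r (powR_gt0 p e20)).
move=> _ [[y _ <-] _].
set C := ([set x | g x <= e / 2] `&` t @^-1` [set y]) `\` B.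
apply: (@le_trans _ _ (maxe 0%E (ereal_sup
    [set `|Lp_repr u w.1 - Lp_repr u w.2|%:E | w in C `*` C]))).
  by apply: ereal_inf_lbound; exists B.
rewrite ge_max lee_fin (ltW e0)/=; apply: ge_ereal_sup.
move=> _ [[w w'] /= [[[gw tw] Bw] [[gw' tw'] Bw']] <-]; rewrite lee_fin.
have /contrapT gE : ~ ~ (`|Lp_repr u w - s w| = g w) by move/gB.
have /contrapT gE' : ~ ~ (`|Lp_repr u w' - s w'| = g w') by move/gB.
have sE : s w = s w' by apply: (tD _ Ds); rewrite tw tw'.
have := ler_distD (s w) (Lp_repr u w) (Lp_repr u w').
by rewrite gE sE (distrC (s w')) gE'; move: gw gw' => /=; lra.
Qed.

End necessity.

(** * Compactness through ultrafilters *)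

(** A cluster point [z] of the image filter is a limit: for a neighborhood [U] of
    [z], either the preimage of [U] or its complement belongs to [G], and the
    complement would keep the image away from [z]. *)
Lemma ultra_compact_cvg (V W : topologicalType) (f : V -> W) (K : set W)
    (G : set_system V) : UltraFilter G -> compact K -> G (f @^-1` K) ->
  exists z : W, f @ G --> z.
Proof.
move=> GU cK GK; have [z [_ zf]] := cK _ (fmap_proper_filter f _) GK.
exists z => U zU; have [//|GC] := in_ultra_setVsetC (f @^-1` U) GU.
have GfC : G (f @^-1` (f @` (~` (f @^-1` U)))).
  by apply: filterS GC => v; exists v.
by have [_ [[v Uv <-]]] := zf _ _ GfC zU.
Qed.

(** Completeness is a hypothesis rather than a structure on [V] so that the lemma
    applies to a space whose completeness is a theorem. *)
Lemma compact_closure_ultra {R : realType} (V : normedModType R) (H : set V) :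
  (forall F : set_system V, ProperFilter F -> cauchy_ex F ->
    exists u : V, F --> u) ->
  (forall G : set_system V, UltraFilter G -> G (closure H) -> cauchy_ex G) ->
  compact (closure H).
Proof.
move=> Vcomplete Hcauchy; rewrite compact_ultra => G GU GH.
have [u Gu] := Vcomplete G _ (Hcauchy G GU GH).
exists u; split => //; apply: closed_closure => U /Gu GU'.
exact: filter_ex (filterI GH GU').
Qed.

Lemma filter_finite_forall {T : Type} {I : choiceType} (F : set_system T)
    (D : set I) (Q : I -> T -> Prop) : Filter F ->
  finite_set D -> (forall i, D i -> \forall x \near F, Q i x) ->
  \forall x \near F, forall i, D i -> Q i x.
Proof.
move=> FF /finite_seqP[s ->]; elim: s => [|i s ih] hQ.
  by apply: filterE => x i.
have Qi := hQ i (mem_head _ _).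
have Qs : \forall x \near F, forall i, [set` s] i -> Q i x.
  by apply: ih => j js; apply: hQ; rewrite /= in_cons js orbT.
move: Qi Qs; apply: filterS2 => x Qi Qs j /=.
by rewrite in_cons => /predU1P[->//|]; exact: Qs.
Qed.

(** * Step functions over a partition and averaging *)

Section step.
Context {d : measure_display} {T : measurableType d} {R : realType}.
Context {X : completeNormedModType R}.
Variable mu : {finite_measure set T -> \bar R}.
Variables (P : set (set T)) (partP : finite_ae_partition mu P).
Implicit Types (c : set T -> X) (f : T -> X).

(** Cells may overlap in null sets, where this is a sum of several values. *)
Definition step c (x : T) : X :=
  \sum_(A <- fset_set P) (if x \in A then c A else 0).

Let finP : finite_set P. Proof. by case: partP. Qed.

Let in_P A : (A \in fset_set P) = (A \in P).
Proof. by rewrite in_fset_set. Qed.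

Let mP A : A \in fset_set P -> measurable A.
Proof. by rewrite in_P inE => PA; case: partP => _ /(_ A PA)[]. Qed.

Let muP A : A \in fset_set P -> (0 < mu A)%E.
Proof. by rewrite in_P inE => PA; case: partP => _ /(_ A PA)[]. Qed.

Lemma ae_in_unique_cell : \forall x \ae mu, exists A,
  [/\ P A, A x & forall B, P B -> B x -> B = A].
Proof.
have [_ _ disj cov] := partP.
have dis : \forall x \ae mu, forall AB, (P `*` P) AB ->
    AB.1 <> AB.2 -> ~ (AB.1 x /\ AB.2 x).
  apply: filter_finite_forall => [|[A B] [/= PA PB]]; first exact: finite_setX.
  have [AB|AB] := pselect (A = B); first by apply: aeW => x /(_ AB).
  exists (A `&` B); split; [|exact: disj|].
    by apply: measurableI; apply: mP; rewrite in_P inE.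
  by move=> x /= h; apply: contrapT => nAB; apply: h => _ h'; apply: nAB.
have tot : \forall x \ae mu, (\bigcup_(A in P) A) x.
  exists (~` \bigcup_(A in P) A); split => //.
  apply: measurableC; apply: fin_bigcup_measurable => // A PA.
  by apply: mP; rewrite in_P inE.
move: dis tot; apply: filterS2 => x dis [A PA Ax].
exists A; split => // B PB Bx; apply: contrapT => BA.
exact: (dis (B, A) (conj PB PA) BA).
Qed.

Lemma stepE c : \forall x \ae mu, forall A, P A -> A x -> step c x = c A.
Proof.
apply: filterS ae_in_unique_cell => x [A [PA Ax uA]] B PB Bx.
have -> : B = A by exact: uA.
rewrite /step.
rewrite (bigD1_seq A) ?fset_uniq ?in_P ?inE//= mem_set//.
rewrite big_seq_cond big1 ?addr0//.
move=> C /andP[]; rewrite in_P inE => PC CA; case: ifPn => //.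
by rewrite inE => Cx; move: CA; rewrite (uA _ PC Cx) eqxx.
Qed.

Lemma simple_step c : simple_function (step c).
Proof.
have h s : {subset s <= fset_set P} -> simple_function
    (fun x => \sum_(A <- s) (if x \in A then c A else 0)).
  elim: s => [|A s ih] sP.
    by under eq_fun do rewrite big_nil; exact: (simple_function_cst 0).
  under eq_fun do rewrite big_cons; apply: simple_functionD.
    apply: simple_function_restrict; last exact: simple_function_cst.
    by apply: mP; apply: sP; rewrite mem_head.
  by apply: ih => B Bs; apply: sP; rewrite in_cons Bs orbT.
exact: h.
Qed.

Lemma integral_cells (u : T -> R) : (forall x, 0 <= u x) ->
  ae_measurable mu u ->
  (\int[mu]_x (u x)%:E =
   \sum_(A <- fset_set P) \int[mu]_x (u x * \1_A x)%:E)%E.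
Proof.
move=> u0 mu_.
have key s : {subset s <= fset_set P} ->
  (\int[mu]_x (\sum_(A <- s) u x * \1_A x)%:E =
   \sum_(A <- s) \int[mu]_x (u x * \1_A x)%:E)%E.
  elim: s => [|A s ih] sP.
    by under eq_integral do rewrite big_nil; rewrite integral0 big_nil.
  have sP' : {subset s <= fset_set P}.
    by move=> B Bs; apply: sP; rewrite in_cons Bs orbT.
  under eq_integral do rewrite big_cons.
  rewrite big_cons -(ih sP') ae_integralD//.
  - by move=> x; exact: mulr_ge0.
  - by move=> x; apply: sumr_ge0 => *; exact: mulr_ge0.
  - apply: ae_measurableM => //; apply: ae_measurable_indic; apply: mP.
    by apply: sP; rewrite mem_head.
  - elim: s sP' {ih sP} => [|B s ih] sP.
      by under eq_fun do rewrite big_nil; exact: ae_measurable_cst.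
    under eq_fun do rewrite big_cons; apply: ae_measurableD.
      apply: ae_measurableM => //; apply: ae_measurable_indic; apply: mP.
      by apply: sP; rewrite mem_head.
    by apply: ih => C Cs; apply: sP; rewrite in_cons Cs orbT.
rewrite -key//; apply: ge0_integral_ae => [x|x|].
- by rewrite lee_fin.
- by rewrite lee_fin; apply: sumr_ge0 => *; exact: mulr_ge0.
apply: filterS ae_in_unique_cell => x [A [PA Ax uA]].
rewrite (bigD1_seq A) ?fset_uniq ?in_P ?inE//= indicE mem_set// mulr1.
rewrite big_seq_cond big1 ?addr0// => C /andP[]; rewrite in_P inE => PC CA.
rewrite indicE memNset ?mulr0// => Cx.
by move: CA; rewrite (uA _ PC Cx) eqxx.
Qed.

Definition cell_average f : set T -> X :=
  fun A => (fine (mu A))^-1 *: bochner_integral mu A f.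

(** Averaging over the cells contracts the norm and fixes step functions, whence
    this estimate. Cell by cell it reads
    [mu A * |average of f - c A| ^ p <= \int_A |f - c A| ^ p], which is Jensen's
    inequality. *)
Lemma step_cell_average_dist (p : R) f c : 1 <= p -> Lp_fun mu p f ->
  (\int[mu]_x (`|step (cell_average f) x - step c x| `^ p)%:E <=
   \int[mu]_x (`|f x - step c x| `^ p)%:E)%E.
Proof.
move=> p1 Hf; have [mf _] := Hf.
have p0 : 0 <= p by exact: le_trans p1.
have ms c' := simple_strongly_measurable mu (simple_step c').
have f1 := Lp_fun_L1 p1 Hf.
rewrite (integral_cells (u := fun x => `|step _ x - step c x| `^ p)); last 2 first.
- by move=> x; exact: powR_ge0.
- exact: ae_measurable_normBp.
rewrite (integral_cells (u := fun x => `|f x - step c x| `^ p)); last 2 first.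
- by move=> x; exact: powR_ge0.
- exact: ae_measurable_normBp.
rewrite big_seq [leRHS]big_seq; apply: lee_sum => A AP.
have mA := mP AP; have muA := muP AP.
have mA0 : 0 < fine (mu A) by rewrite fine_gt0// muA ltey_eq fin_num_measure.
have onA u : (\int[mu]_x (`|u x - step c x| `^ p * \1_A x)%:E =
     \int[mu]_x (`|u x - c A| `^ p * \1_A x)%:E)%E.
  apply: ge0_integral_ae => [x|x|].
  - by rewrite lee_fin mulr_ge0// powR_ge0.
  - by rewrite lee_fin mulr_ge0// powR_ge0.
  apply: filterS (stepE c) => x /(_ A) h; rewrite indicE.
  case: (boolP (x \in A)) => [xA|_]; last by rewrite !mulr0.
  by rewrite h//; [rewrite in_P inE in AP|rewrite inE in xA].
rewrite !onA//.
have -> : (\int[mu]_x (`|step (cell_average f) x - c A| `^ p * \1_A x)%:E =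
    (`|cell_average f A - c A| `^ p)%:E * mu A)%E.
  rewrite -(integral_indicE mu mA) -ae_integralZ ?powR_ge0//; last first.
    exact: ae_measurable_indic.
  apply: ge0_integral_ae => [x|x|].
  - by rewrite lee_fin mulr_ge0// powR_ge0.
  - by rewrite lee_fin mulr_ge0// powR_ge0.
  apply: filterS (stepE (cell_average f)) => x /(_ A) h; rewrite indicE.
  case: (boolP (x \in A)) => [xA|_]; last by rewrite !mulr0.
  by rewrite h//; [rewrite in_P inE in AP|rewrite inE in xA].
have c1 : Lp_fun mu 1 (cst (c A)).
  exact: (Lp_fun_simple mu ler01 (simple_function_cst (c A))).
have := le_dist_bochner_integral mA f1 c1.
rewrite bochner_integral_cst// => h.
have := jensen_powR p1 mA muA (ae_measurable_normB mf (proj1 c1))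
  (fun=> normr_ge0 _) (normr_ge0 _) h.
apply: le_trans; rewrite muleC -[X in (X * _)%E]fineK ?fin_num_measure//.
rewrite -EFinM lee_fin le_eqVlt; apply/orP; left; apply/eqP; congr (_ * _ `^ _).
have -> : cell_average f A - c A =
    (fine (mu A))^-1 *: (bochner_integral mu A f - fine (mu A) *: c A).
  by rewrite scalerBr scalerA mulVf ?gt_eqF// scale1r.
by rewrite normrZ normfV gtr0_norm// mulrC.
Qed.

Lemma step_dist_le (p e : R) c c' : 1 <= p -> 0 <= e ->
  (forall A, P A -> `|c A - c' A| <= e) ->
  (\int[mu]_x (`|step c x - step c' x| `^ p)%:E <= (e `^ p)%:E * mu setT)%E.
Proof.
move=> p1 e0 ce; rewrite -integral_cstE; apply: ae_le_integral => [x|x|].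
- exact: powR_ge0.
- exact: powR_ge0.
move: ae_in_unique_cell (stepE c) (stepE c'); apply: filterS3.
move=> x [A [PA Ax _]] cA c'A; rewrite (cA A)// (c'A A)//.
by apply: ge0_ler_powR; rewrite ?nnegrE ?ce// (le_trans _ p1).
Qed.

End step.

(** * The three conditions imply relative compactness *)

Section approx.
Context {d : measure_display} {T : measurableType d} {R : realType}.
Context {X : completeNormedModType R}.
Variable mu : {finite_measure set T -> \bar R}.
Implicit Types (P : set (set T)) (f : T -> X).

(** On [Of `&` A] the function oscillates by less than [2 * e] off a null set, so
    any of its values there can serve as [c A]. A value of norm at most [M] is
    chosen when there is one; otherwise the conclusion is void on [A] and [0]
    does. *)
Lemma ess_osc_constants P f (Of : set T) (e M : R) :
  finite_ae_partition mu P -> 0 < e -> 0 <= M ->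
  (forall A, P A -> (ess_osc mu f (Of `&` A) <= e%:E)%E) ->
  exists c : set T -> X, (forall A, `|c A| <= M) /\
    \forall x \ae mu, forall A, P A -> A x -> Of x -> `|f x| <= M ->
      `|f x - c A| <= 2 * e.
Proof.
move=> [finP _ _ _] e0 M0 osc.
have /choice[B BP] A : exists B : set T, P A -> [/\ measurable B, mu B = 0%E &
    forall x x', Of x -> A x -> ~ B x -> Of x' -> A x' -> ~ B x' ->
      `|f x - f x'| <= 2 * e].
  have [PA|nPA] := pselect (P A); last by exists set0.
  have : (ess_osc mu f (Of `&` A) < (2 * e)%:E)%E.
    by apply: le_lt_trans (osc A PA) _; rewrite lte_fin; lra.
  move=> /ereal_inf_lt[_ [B [mB B0] <-] supB]; exists B => _; split => //.
  move=> x x' Ox Ax Bx Ox' Ax' Bx'; rewrite -lee_fin.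
  apply/ltW/le_lt_trans/supB; rewrite le_max; apply/orP; right.
  by apply: ereal_sup_ubound; exists (x, x').
have /choice[c cP] A : exists v : X, `|v| <= M /\
    forall x, P A -> Of x -> A x -> ~ B A x -> `|f x| <= M -> `|f x - v| <= 2 * e.
  have [[w [PA Ow Aw Bw fw]]|nw] :=
      pselect (exists w, [/\ P A, Of w, A w, ~ B A w & `|f w| <= M]).
    exists (f w); split => // x _ Ox Ax Bx fx.
    by have [_ _ oscB] := BP A PA; exact: oscB.
  exists 0; rewrite normr0; split => // x PA Ox Ax Bx fx.
  by exfalso; apply: nw; exists x.
exists c; split => [A|]; first by case: (cP A).
have : \forall x \ae mu, forall A, P A -> ~ B A x.
  apply: filter_finite_forall => // A PA; have [mB B0 _] := BP A PA.
  by exists (B A); split => // x /=; apply: contrapT.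
apply: filterS => x Bx A PA Ax Ox fx.
by have [_ h] := cP A; apply: h => //; exact: Bx.
Qed.

(** With [K = M ^ (1/p)], the distance from [f x] to its cell's constant is
    at most [2 |f x|] where [|f x| ^ p > M], at most [2 e] elsewhere on [Of], and
    at most [2 K] on the rest. The order of choices matters: uniform
    integrability gives [M] first, then [e] is chosen small with respect to [M]
    so that the exceptional set, of measure at most [e], contributes little. *)
Lemma uniform_step_approx (p : R) (H : set (T -> X)) : 1 <= p ->
  (forall f, H f -> strongly_measurable mu f) ->
  frechet_oscillation mu H -> p_uniformly_integrable mu p H ->
  forall eta : R, 0 < eta -> exists P, finite_ae_partition mu P /\
    forall f, H f -> exists c : set T -> X,
      (\int[mu]_x (`|f x - step P c x| `^ p)%:E <= eta%:E)%E.
Proof.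
move=> p1 Hm HF HUI eta eta0; have p0 : 0 < p by lra.
have p2 : 0 < 2 `^ p :> R by exact: powR_gt0.
have e10 : 0 < eta / (2 * 2 `^ p) by rewrite divr_gt0// !mulr_gt0.
have [M0 [M0r M0P]] := HUI _ e10.
pose M := Num.max (M0 + 1) 0.
have M_ge0 : 0 <= M by rewrite le_max lexx orbT.
have M0M : M0 < M by rewrite lt_max; apply/orP; left; lra.
pose K := M `^ p^-1.
have K0 : 0 <= K by exact: powR_ge0.
have KM : K `^ p = M by rewrite -powRrM mulVf ?gt_eqF// powRr1.
set m := fine (mu setT).
have mT : mu setT = m%:E by rewrite fineK// fin_num_measure.
have m0 : 0 <= m by rewrite fine_ge0.
(* [Q] collects what [e] multiplies in the final bound: [2 * m] from [Of], since
   [(2 * e) ^ p <= 2 * e] for [e <= 1 / 2], and [(2 * K) ^ p] from the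
   exceptional set. *)
pose Q := 2 * m + (2 * K) `^ p + 1.
have Q0 : 0 < Q by rewrite /Q; have := powR_ge0 (2 * K) p; lra.
pose e := Num.min 2^-1 (eta / (2 * Q)).
have e0 : 0 < e.
  by rewrite lt_min invr_gt0 ltr0n/= divr_gt0// !mulr_gt0.
have e2 : e <= 2^-1 by rewrite ge_min lexx.
have eQ : e * Q <= eta / 2.
  have : e <= eta / (2 * Q) by rewrite ge_min lexx orbT.
  rewrite ler_pdivlMr ?mulr_gt0// => h; rewrite ler_pdivlMr//.
  by apply: le_trans h; rewrite le_eqVlt; apply/orP; left; apply/eqP; ring.
have [P partP HP] := HF e e0.
exists P; split => // f Hf; have [Of [mOf muOf osc]] := HP f Hf.
have mf := Hm f Hf.
have [c [cK cf]] := ess_osc_constants partP e0 K0 osc.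
exists c.
pose big t : R := t * \1_[set t | M < t] t.
have big0 t : 0 <= t -> 0 <= big t by move=> t0; rewrite mulr_ge0.
have mbig : measurable_fun setT big.
  apply: measurable_funM => //; apply: measurable_indic.
  rewrite (_ : [set t | M < t] = `]M, +oo[%classic)//.
  by apply/seteqP; split => t /=; rewrite in_itv/= andbT.
have mOfC := measurableC mOf.
have bound : \forall x \ae mu, `|f x - step P c x| `^ p <=
    ((2 * e) `^ p + 2 `^ p * big (`|f x| `^ p)) + (2 * K) `^ p * \1_(~` Of) x.
  move: (ae_in_unique_cell partP) (stepE partP c) cf; apply: filterS3.
  move=> x [A [PA Ax _]] cA /(_ A PA Ax) cf; rewrite (cA A)//.
  have t1 := powR_ge0 (2 * e) p.
  have t2 : 0 <= 2 `^ p * big (`|f x| `^ p).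
    by rewrite mulr_ge0// ?powR_ge0// big0// powR_ge0.
  have t3 : 0 <= (2 * K) `^ p * \1_(~` Of) x by rewrite mulr_ge0// powR_ge0.
  have fcK : `|f x - c A| <= `|f x| + K.
    by apply: (le_trans (ler_normB _ _)); rewrite lerD2l.
  have [fM|fM] := ltP M (`|f x| `^ p).
    have -> : big (`|f x| `^ p) = `|f x| `^ p.
      by rewrite /big indicE mem_set// mulr1.
    apply: (@le_trans _ _ ((2 * `|f x|) `^ p)).
      rewrite ler_powR_base// ?mulr_ge0//; apply: (le_trans fcK).
      have : K <= `|f x| by rewrite -(ler_powR_base p1)// KM ltW.
      lra.
    by rewrite (@powRM _ 2 `|f x|)// -[leLHS]add0r -[leLHS]addr0 lerD// lerD.
  have fK : `|f x| <= K by rewrite -(ler_powR_base p1)// KM.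
  have [Ox|nOx] := pselect (Of x).
    have := cf Ox fK; rewrite -(ler_powR_base p1)// ?mulr_ge0 ?(ltW e0)//; lra.
  have -> : \1_(~` Of) x = 1 :> R by rewrite indicE mem_set.
  have : `|f x - c A| <= 2 * K by lra.
  rewrite -(ler_powR_base p1)// ?mulr_ge0//; lra.
have mfp := ae_measurable_powR p (ae_measurable_norm mf).
have mbigf := ae_measurable_comp mbig mfp.
have bigf0 x : 0 <= big (`|f x| `^ p) by rewrite big0 ?powR_ge0.
apply: (@le_trans _ _ ((((2 * e) `^ p)%:E * mu setT +
    (2 `^ p)%:E * (eta / (2 * 2 `^ p))%:E) +
    ((2 * K) `^ p)%:E * mu (~` Of))%E).
  apply: (@le_trans _ _ ((
      \int[mu]_x ((2 * e) `^ p + 2 `^ p * big (`|f x| `^ p))%:E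
      + \int[mu]_x ((2 * K) `^ p * \1_(~` Of) x)%:E)%E)).
    apply: ae_le_integralD => //.
    - by move=> x; rewrite addr_ge0 ?powR_ge0// mulr_ge0// powR_ge0.
    - by move=> x; rewrite mulr_ge0// powR_ge0.
    - apply: ae_measurableD; first exact: ae_measurable_cst.
      by apply: ae_measurableM; first exact: ae_measurable_cst.
    - apply: ae_measurableM; first exact: ae_measurable_cst.
      exact: ae_measurable_indic.
  rewrite ae_integralZ ?powR_ge0//; last exact: ae_measurable_indic.
  rewrite integral_indicE// leeD2r// ae_integralD//; first last.
  - by apply: ae_measurableM; first exact: ae_measurable_cst.
  - exact: ae_measurable_cst.
  - by move=> x; rewrite mulr_ge0// powR_ge0.
  - by move=> x; exact: powR_ge0.
  rewrite integral_cstE leeD2l// ae_integralZ ?powR_ge0//.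
  rewrite lee_pmul2l// ?lte_fin//.
  apply: le_trans (M0P M M0M f Hf); rewrite [leRHS]integral_mkcond le_eqVlt.
  apply/orP; left; apply/eqP; apply: eq_integral => x _.
  rewrite patchE /big indicE; case: (boolP (x \in _)) => xM.
    by rewrite mem_set ?mulr1//; move: xM; rewrite inE.
  by rewrite memNset ?mulr0// => h; move: xM; rewrite notin_setE; apply.
have e2p : (2 * e) `^ p <= 2 * e.
  by apply: ge1r_powR => //; apply/andP; split; lra.
have muOf' : fine (mu (~` Of)) <= e.
  by rewrite -lee_fin fineK// fin_num_measure.
rewrite mT -[mu (~` Of)]fineK ?fin_num_measure// -!EFinM -!EFinD lee_fin.
have -> : 2 `^ p * (eta / (2 * 2 `^ p)) = eta / 2 by field; rewrite gt_eqF.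
have h1 : (2 * e) `^ p * m <= 2 * e * m by rewrite ler_wpM2r.
have h2 : (2 * K) `^ p * fine (mu (~` Of)) <= (2 * K) `^ p * e.
  by rewrite ler_wpM2l// powR_ge0.
have : e * Q = 2 * e * m + (2 * K) `^ p * e + e by rewrite /Q; ring.
lra.
Qed.

End approx.

Section sufficiency.
Context {d : measure_display} {T : measurableType d} {R : realType}.
Variables (mu : {finite_measure set T -> \bar R}) (X : completeNormedModType R).
Variables (p : R) (p1 : 1 <= p).
Local Notation L := (Lp mu X p1).
Implicit Types (H : set L) (u v : L).

Let p0 : 0 < p. Proof. exact: lt_le_trans p1. Qed.

(** Along an ultrafilter on the closure of [H], each of the finitely many cell
    integrals converges, as it lives in a compact set. Hence the cell averages,
    which are uniformly close to the functions themselves, converge in norm, and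
    the ultrafilter is Cauchy. *)
Lemma frechet_tight_compact H :
  frechet_oscillation mu [set Lp_repr f | f in H] ->
  integral_tight mu [set Lp_repr f | f in H] ->
  p_uniformly_integrable mu p [set Lp_repr f | f in H] ->
  compact (closure H).
Proof.
move=> HF HT HUI; apply: compact_closure_ultra; first exact: Lp_complete.
move=> G GU GH e e0.
have e80 : 0 < e / 8 by rewrite divr_gt0.
have [P [partP HP]] : exists P, finite_ae_partition mu P /\
    forall f, [set Lp_repr f | f in H] f -> exists c : set T -> X,
      (\int[mu]_x (`|f x - step P c x| `^ p)%:E <= ((e / 8) `^ p)%:E)%E.
  apply: uniform_step_approx => //; last exact: powR_gt0.
  by move=> _ [u _ <-]; have [] := Lp_reprP u.
pose stepL c : L :=
  Lp_class p1 (Lp_fun_simple mu (ltW p0) (simple_step partP c)).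
pose avg u := stepL (cell_average mu (Lp_repr u)).
have avgP u : closure H u -> `|u - avg u| < e / 2.
  move=> Hu; have [u' [Hu' uu']] := Hu _ (nbhsx_ballx u _ e80).
  have [c cP] := HP (Lp_repr u') (imageP _ Hu').
  have u'c : `|u' - stepL c| <= e / 8.
    by rewrite -(ler_powR_base p1)// ?(ltW e80)// -lee_fin Lp_dist_class.
  have uc : `|u - stepL c| < e / 4.
    move: uu'; rewrite -ball_normE /ball_/= => uu'.
    have := ler_distD u' u (stepL c); lra.
  have avgc : `|avg u - stepL c| <= `|u - stepL c|.
    rewrite -(ler_powR_base p1)// -lee_fin /avg /stepL.
    rewrite Lp_class_dist_class Lp_dist_class.
    exact: step_cell_average_dist (Lp_reprP u).
  have := ler_distD (stepL c) u (avg u); rewrite (distrC (stepL c)); lra.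
have zP A : P A -> exists z : X,
    bochner_integral mu A (Lp_repr u) @[u --> G] --> z.
  move=> PA.
  have [mA _] : measurable A /\ (0 < mu A)%E by case: (partP) => _ /(_ A PA).
  have := HT A mA; rewrite image_comp => /(ultra_compact_cvg GU); apply.
  have /continuous_closedP cont :=
    @bochner_integral_continuous _ _ _ mu X p p1 A mA.
  set I := [set _ | _ in _]; apply: filterS GH.
  rewrite [X in _ `<=` X](closure_id _).1;
    last exact: cont (@closed_closure _ I).
  by apply: closure_subset => u Hu; apply: subset_closure; exists u.
have /choice[z zPA] A : exists z : X, P A ->
    bochner_integral mu A (Lp_repr u) @[u --> G] --> z.
  have [/zP[z zA]|nPA] := pselect (P A); first by exists z.
  by exists 0.
pose c A := (fine (mu A))^-1 *: z A.
exists (stepL c).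
set m := fine (mu setT).
have mT : mu setT = m%:E by rewrite fineK// fin_num_measure.
have m0 : 0 <= m by rewrite fine_ge0.
(* Chosen so that [del ^ p * m <= (e / 4) ^ p]; the [+ 1] covers [m = 0]. *)
pose del := e / 4 * (m + 1)^-1 `^ p^-1.
have del0 : 0 < del.
  by rewrite mulr_gt0 ?divr_gt0// powR_gt0// invr_gt0 ltr_wpDl.
have Gc : \forall u \near G, forall A, P A ->
    `|cell_average mu (Lp_repr u) A - c A| <= del.
  apply: filter_finite_forall => [|A PA]; first by case: (partP).
  have [mA muA] : measurable A /\ (0 < mu A)%E by case: (partP) => _ /(_ A PA).
  have mA0 : 0 < fine (mu A) by rewrite fine_gt0// muA ltey_eq fin_num_measure.
  have /cvgrPdist_lt := zPA A PA.
  move=> /(_ _ (mulr_gt0 mA0 del0)); apply: filterS => u zu.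
  rewrite /cell_average /c -scalerBr normrZ normfV gtr0_norm// distrC.
  by rewrite mulrC ler_pdivrMr// mulrC ltW.
apply: filterS (filterI GH Gc) => u [Hu uc].
rewrite -ball_normE /ball_/=.
have avgc : `|avg u - stepL c| <= e / 4.
  have e40 : 0 <= e / 4 by rewrite divr_ge0// ltW.
  rewrite -(ler_powR_base p1)// -lee_fin /avg /stepL Lp_class_dist_class.
  apply: (le_trans (step_dist_le partP p1 (ltW del0) uc)).
  rewrite mT -EFinM lee_fin /del powRM ?powR_ge0//.
  rewrite -powRrM mulVf ?gt_eqF// powRr1 ?invr_ge0 ?addr_ge0// -mulrA.
  rewrite ler_piMr ?powR_ge0// mulrC ler_pdivrMr ?mul1r; lra.
have := avgP u Hu; have := ler_distD (avg u) u (stepL c).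
by rewrite (distrC (stepL c)); lra.
Qed.

End sufficiency.

Theorem theorem1 (d : measure_display) (T : measurableType d) (R : realType)
    (mu : {finite_measure set T -> \bar R}) (X : completeNormedModType R)
    (p : R) (p1 : 1 <= p) (H : set (Lp mu X p1)) :
  compact (closure H) <->
  [/\ frechet_oscillation mu [set Lp_repr f | f in H],
      integral_tight mu [set Lp_repr f | f in H] &
      p_uniformly_integrable mu p [set Lp_repr f | f in H]].
Proof.
split=> [cH|[HF HT HUI]]; last exact: frechet_tight_compact.
split; [exact: compact_frechet_oscillation|exact: compact_integral_tight|].
exact: compact_p_uniformly_integrable.
Qed.
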